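(* Let $\mathbb{C}$ be a locally cartesian closed category with finite limits and pushouts. Let $m$ be a vertical map over the codomain fibration $\mathrm{cod}\colon\mathbb{C}^{\mathbf 2}\to\mathbb{C}$. (1) Step-one of the small object argument on $m$ is well defined, giving an lawfs $(L_1,R_1)$, where the $R_1$-algebra structures on a family of maps $f$ correspond precisely to solutions of the universal lifting problem of $f$ against $m$ (i.e. from $m$ to $f$). (2) $(L_1,R_1)$ is a fibred lawfs. (3) If the awfs algebraically free on $(L_1,R_1)$ exists, then it is also fibred.
   Context: Write $p\colon\mathbb{E}\to\mathbb{B}$ for the fibration $\mathrm{cod}\colon\mathbb{C}^{\mathbf 2}\to\mathbb{C}$; cartesian maps are pullback squares and reindexing is pullback. A vertical map (family of maps) over $I$ is a morphism of $\mathbb{C}/I$. $V(\mathbb{E})$ is the full subcategory of $\mathbb{E}^{\mathbf 2}$ on vertical maps; it has functors $\mathrm{dom},\mathrm{cod}\colon V(\mathbb{E})\to\mathbb{E}$ and is fibred over $\mathbb{B}$ via $p\circ\mathrm{dom}=p\circ\mathrm{cod}$. ''Over $\mathrm{cod}$'' (resp. $\mathrm{dom}$) means commuting with that functor $V(\mathbb{E})\to\mathbb{E}$, with structural transformations having identity codomain (resp. domain) components. Lifting problems. Let $m\colon U\to V$ be vertical over $I$, $f\colon X\to Y$ vertical over $J$. A family of lifting problems from $m$ to $f$ over $K$ is $\sigma\colon K\to I$, $\tau\colon K\to J$ and a morphism $h\colon\sigma^*(m)\to f$ of $V(\mathbb{E})$ over $\tau$; a solution is $j\colon\sigma^*(V)\to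 X$ over $\tau$ making both triangles commute. The universal one, $(\underline{\mathrm{Hom}}(m,f),\sigma_f,\tau_f,h_f)$, is such that every family $(K,\sigma,\tau,h)$ equals $(\sigma_ft,\tau_ft,h_fc)$ for a unique $t\colon K\to\underline{\mathrm{Hom}}(m,f)$, $c\colon\sigma^*(m)\to\sigma_f^*(m)$ the canonical cartesian map over $t$. Factorisations. A functorial factorisation over $\mathbb{B}$ functorially factors each vertical $f\colon X\to Y$ as $X\xrightarrow{Lf}Kf\xrightarrow{Rf}Y$ with both maps vertical (over $\mathbb{B}$). $R$ is a pointed endofunctor over $\mathrm{cod}$ with unit $\lambda_f=(Lf,1_Y)$; $L$ is a copointed endofunctor over $\mathrm{dom}$ with counit $(1_X,Rf)$. An $R$-algebra structure on $f$ is $\alpha\colon Rf\to f$ in $V(\mathbb{E})$ with $\alpha\lambda_f=1$. An lawfs adds $\Sigma\colon L\Rightarrow L^2$ making $L$ a comonad over $\mathrm{dom}$; an awfs adds such a $\Sigma$ and $\Pi\colon R^2\Rightarrow R$ making $R$ a monad over $\mathrm{cod}$, such that the canonical $LR\Rightarrow RL$ (component at $f$: domain part the codomain component $Kf\to KLf$ of $\Sigma_f$, codomain part the domain component $KRf\to Kf$ of $\Pi_f$) is a distributive law. Any of these is fibred if $f\mapsto(Lf,Rf)$ preserves cartesian maps over $\mathbb{B}$ (equivalently $R$ preserves cartesian maps of $V(\mathbb{E})$ over $\mathbb{B}$). Step-one on $m$. Factor $h_f=\epsilon_fk_f$ with $k_f\colon\sigma_f^*(m)\to L_1f$ opcartesian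 over $\mathrm{dom}\colon V(\mathbb{E})\to\mathbb{E}$ and $\epsilon_f\colon L_1f\to f$ having identity domain component; $R_1f$ is the codomain component of the counit $\epsilon_f$. (Explicitly, $L_1f$ is the pushout in $\mathbb{C}$ of $\sigma_f^*(m)$ along the map $\sigma_f^*(U)\to X$.) The comultiplication $\Sigma_f$ is the unique map with identity domain component with $\Sigma_fk_f=k_{L_1f}s$, where $s\colon\sigma_f^*(m)\to\sigma_{L_1f}^*(m)$ is compatible with the cartesian maps to $m$ and $h_{L_1f}s=k_f$. Algebraically free. A morphism of lawfs's is a natural family of vertical maps $Kf\to K'f$ compatible with the factorisations and comultiplications; it induces $(R',\lambda')\text{-Alg}\to(R,\lambda)\text{-Alg}$. An awfs $(L',R')$ is algebraically free on $(L,R)$ if it is equipped with a morphism of lawfs's $(L,R)\to(L',R')$ such that the composite $(R',\lambda',\Pi')\text{-Alg}\to(R',\lambda')\text{-Alg}\to(R,\lambda)\text{-Alg}$ (monad algebras, then pointed endofunctor algebras) is an isomorphism. *)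

(* Defs.v *)
From Stdlib Require Import List ProofIrrelevance.

Set Implicit Arguments.
Unset Strict Implicit.
Unset Printing Implicit Defensive.

Declare Scope cat_scope.
Delimit Scope cat_scope with cat.
Open Scope cat_scope.

Record category := Category {
  ob :> Type;
  hom : ob -> ob -> Type;
  idc : forall x, hom x x;
  comp : forall x y z, hom y z -> hom x y -> hom x z;
  comp_idl : forall x y (f : hom x y), comp (idc y) f = f;
  comp_idr : forall x y (f : hom x y), comp f (idc x) = f;
  comp_assoc : forall w x y z (h : hom y z) (g : hom x y) (f : hom w x),
    comp h (comp g f) = comp (comp h g) f }.

Arguments hom {c} x y.
Arguments idc {c} x.
Arguments comp {c x y z} g f : rename.
Notation "g ∘ f" := (comp g f) (at level 40, left associativity) : cat_scope.

Record functor (C D : category) := Functor {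
  fob :> C -> D;
  fmap : forall x y, hom x y -> hom (fob x) (fob y);
  fmap_id : forall x, fmap (idc x) = idc (fob x);
  fmap_comp : forall x y z (g : hom y z) (f : hom x y),
    fmap (g ∘ f) = fmap g ∘ fmap f }.

Arguments fmap {C D} F {x y} f : rename.

Program Definition fcomp (C D E : category) (G : functor D E) (F : functor C D) :
  functor C E :=
  @Functor C E (fun x => G (F x)) (fun x y f => fmap G (fmap F f)) _ _.
Next Obligation. now rewrite !fmap_id. Qed.
Next Obligation. now rewrite !fmap_comp. Qed.

Program Definition full_subcat (C : category) (P : C -> Prop) : category :=
  @Category {x : C | P x} (fun x y => hom (proj1_sig x) (proj1_sig y))
    (fun x => idc (proj1_sig x)) (fun x y z g f => g ∘ f) _ _ _.
Next Obligation. apply comp_idl. Qed.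
Next Obligation. apply comp_idr. Qed.
Next Obligation. apply comp_assoc. Qed.

Definition full_incl (C : category) (P : C -> Prop) : functor (full_subcat P) C :=
  @Functor (full_subcat P) C (fun x => proj1_sig x) (fun x y f => f)
    (fun x => eq_refl) (fun x y z g f => eq_refl).

(** Strict isomorphism; equivalent to having a two-sided inverse functor. *)
Definition is_cat_iso (C D : category) (F : functor C D) : Prop :=
  (forall d : D, exists! c : C, F c = d) /\
  (forall (x y : C) (g : hom (F x) (F y)), exists! f : hom x y, fmap F f = g).

Definition is_cartesian (D B : category) (P : functor D B) (x y : D) (h : hom x y)
  : Prop :=
  forall (z : D) (k : hom z y) (t : hom (P z) (P x)), fmap P h ∘ t = fmap P k ->
  exists! l : hom z x, fmap P l = t /\ h ∘ l = k.

Definition is_opcartesian (D B : category) (P : functor D B) (x y : D) (h : hom x y)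
  : Prop :=
  forall (z : D) (k : hom x z) (t : hom (P y) (P z)), t ∘ fmap P h = fmap P k ->
  exists! l : hom y z, fmap P l = t /\ l ∘ h = k.

Definition finite_type (T : Type) : Prop := exists l : list T, forall x, In x l.

Definition finite_category (J : category) : Prop :=
  finite_type J /\ forall i j : J, finite_type (hom i j).

Definition is_cone (J C : category) (D : functor J C) (x : C)
  (p : forall i, hom x (D i)) : Prop :=
  forall (i j : J) (u : hom i j), fmap D u ∘ p i = p j.

Definition is_limit (J C : category) (D : functor J C) (x : C)
  (p : forall i, hom x (D i)) : Prop :=
  is_cone p /\
  forall (y : C) (q : forall i, hom y (D i)), is_cone q ->
  exists! u : hom y x, forall i, p i ∘ u = q i.

Definition has_finite_limits (C : category) : Prop :=
  forall (J : category) (D : functor J C), finite_category J ->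
  exists (x : C) (p : forall i, hom x (D i)), is_limit p.

Definition is_pushout (C : category) (a b c d : C) (f : hom a b) (g : hom a c)
  (i : hom b d) (j : hom c d) : Prop :=
  i ∘ f = j ∘ g /\
  forall (x : C) (u : hom b x) (v : hom c x), u ∘ f = v ∘ g ->
  exists! w : hom d x, w ∘ i = u /\ w ∘ j = v.

Definition has_pushouts (C : category) : Prop :=
  forall (a b c : C) (f : hom a b) (g : hom a c),
  exists (d : C) (i : hom b d) (j : hom c d), is_pushout f g i j.

Definition is_terminal (C : category) (x : C) : Prop :=
  forall y : C, exists! u : hom y x, True.

Definition is_product (C : category) (a b p : C) (p1 : hom p a) (p2 : hom p b) : Prop :=
  forall (x : C) (u : hom x a) (v : hom x b),
  exists! w : hom x p, p1 ∘ w = u /\ p2 ∘ w = v.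

(** [u] below is the map [g × a : x × a -> e × a]. *)
Definition is_exponential (C : category) (a b e p : C) (p1 : hom p e) (p2 : hom p a)
  (ev : hom p b) : Prop :=
  is_product p1 p2 /\
  forall (x q : C) (q1 : hom q x) (q2 : hom q a), is_product q1 q2 ->
  forall f : hom q b, exists! g : hom x e,
    exists u : hom q p, p1 ∘ u = g ∘ q1 /\ p2 ∘ u = q2 /\ ev ∘ u = f.

Definition is_cartesian_closed (C : category) : Prop :=
  (exists x : C, is_terminal x) /\
  (forall a b : C, exists (p : C) (p1 : hom p a) (p2 : hom p b), is_product p1 p2) /\
  (forall a b : C, exists (e p : C) (p1 : hom p e) (p2 : hom p a) (ev : hom p b),
    is_exponential p1 p2 ev).

Lemma sig_eq (A : Type) (P : A -> Prop) (x y : sig P) :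
  proj1_sig x = proj1_sig y -> x = y.
Proof.
destruct x as [x px], y as [y py]; simpl; intros ->.
now rewrite (proof_irrelevance _ px py).
Qed.

Program Definition slice (C : category) (I : C) : category :=
  @Category {x : C & hom x I}
    (fun x y => {f : hom (projT1 x) (projT1 y) | projT2 y ∘ f = projT2 x})
    (fun x => idc _) (fun x y z g f => proj1_sig g ∘ proj1_sig f) _ _ _.
Next Obligation. apply comp_idr. Qed.
Next Obligation. now rewrite comp_assoc. Qed.
Next Obligation. apply sig_eq; apply comp_idl. Qed.
Next Obligation. apply sig_eq; apply comp_idr. Qed.
Next Obligation. apply sig_eq; apply comp_assoc. Qed.

Definition is_lccc (C : category) : Prop :=
  forall I : C, is_cartesian_closed (slice I).

Record arr_ob (C : category) := ArrOb {
  asrc : C; atgt : C; aarr : hom asrc atgt }.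

Record arr_hom (C : category) (x y : arr_ob C) := ArrHom {
  atop : hom (asrc x) (asrc y);
  abot : hom (atgt x) (atgt y);
  asquare : aarr y ∘ atop = abot ∘ aarr x }.

Lemma arr_hom_eq (C : category) (x y : arr_ob C) (h k : arr_hom x y) :
  atop h = atop k -> abot h = abot k -> h = k.
Proof.
destruct h as [t b s], k as [t' b' s']; simpl; intros -> ->.
now rewrite (proof_irrelevance _ s s').
Qed.

Program Definition arrow_cat (C : category) : category :=
  @Category (arr_ob C) (@arr_hom C)
    (fun x => @ArrHom C x x (idc _) (idc _) _)
    (fun x y z g f => @ArrHom C x z (atop g ∘ atop f) (abot g ∘ abot f) _) _ _ _.
Next Obligation. now rewrite comp_idl, comp_idr. Qed.
Next Obligation. now rewrite comp_assoc, asquare, <- comp_assoc, asquare, comp_assoc. Qed.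
Next Obligation. apply arr_hom_eq; apply comp_idl. Qed.
Next Obligation. apply arr_hom_eq; apply comp_idr. Qed.
Next Obligation. apply arr_hom_eq; apply comp_assoc. Qed.

Definition codF (C : category) : functor (arrow_cat C) C :=
  @Functor (arrow_cat C) C (@atgt C) (fun x y f => abot f)
    (fun x => eq_refl) (fun x y z g f => eq_refl).

(** A vertical map over [vbase] is a map [varr : vdom -> vcod] of the slice over
    [vbase].  The structure map of its domain is [vproj ∘ varr], which makes the
    triangle over [vbase] commute by construction. *)
Record vmap (C : category) := VMap {
  vbase : C;
  vcod : C;
  vdom : C;
  vproj : hom vcod vbase;
  varr : hom vdom vcod }.

(** A commutative square of the arrow category between vertical maps: both of its
    vertices lie over the same map [hbase], as the two vertical sides have identity
    base component. *)
Record vhom (C : category) (f g : vmap C) := VHom {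
  hbase : hom (vbase f) (vbase g);
  hcod : hom (vcod f) (vcod g);
  hdom : hom (vdom f) (vdom g);
  hproj : vproj g ∘ hcod = hbase ∘ vproj f;
  hsquare : varr g ∘ hdom = hcod ∘ varr f }.

Lemma vhom_eq (C : category) (f g : vmap C) (h k : vhom f g) :
  hbase h = hbase k -> hcod h = hcod k -> hdom h = hdom k -> h = k.
Proof.
destruct h as [b c d p s], k as [b' c' d' p' s']; simpl; intros -> -> ->.
now rewrite (proof_irrelevance _ p p'), (proof_irrelevance _ s s').
Qed.

Program Definition vert_cat (C : category) : category :=
  @Category (vmap C) (@vhom C)
    (fun f => @VHom C f f (idc _) (idc _) (idc _) _ _)
    (fun f g k v u => @VHom C f k (hbase v ∘ hbase u) (hcod v ∘ hcod u)
                        (hdom v ∘ hdom u) _ _) _ _ _.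
Next Obligation. now rewrite comp_idl, comp_idr. Qed.
Next Obligation. now rewrite comp_idl, comp_idr. Qed.
Next Obligation. now rewrite comp_assoc, hproj, <- comp_assoc, hproj, comp_assoc. Qed.
Next Obligation. now rewrite comp_assoc, hsquare, <- comp_assoc, hsquare, comp_assoc. Qed.
Next Obligation. apply vhom_eq; apply comp_idl. Qed.
Next Obligation. apply vhom_eq; apply comp_idr. Qed.
Next Obligation. apply vhom_eq; apply comp_assoc. Qed.

Program Definition vdomF (C : category) : functor (vert_cat C) (arrow_cat C) :=
  @Functor (vert_cat C) (arrow_cat C)
    (fun f => ArrOb (vproj f ∘ varr f))
    (fun f g h => @ArrHom C (ArrOb (vproj f ∘ varr f)) (ArrOb (vproj g ∘ varr g))
                    (hdom h) (hbase h) _) _ _.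
Next Obligation.
now rewrite <- comp_assoc, hsquare, comp_assoc, hproj, <- comp_assoc.
Qed.
Next Obligation. now apply arr_hom_eq. Qed.
Next Obligation. now apply arr_hom_eq. Qed.

(** On objects and arrows this is [vbase] and [hbase]. *)
Definition vfib (C : category) : functor (vert_cat C) C := fcomp (codF C) (vdomF C).

(** A family of lifting problems from [m] to [f].  Reindexing is only determined up to
    canonical isomorphism, so the reindexing of [m] is any vertical map [lp_map] with a
    cartesian map [lp_cart] to [m]; then [K], [σ] and [τ] are given by [lp_index],
    [lp_sigma] and [lp_tau] below. *)
Record lifting_problem (C : category) (m f : vert_cat C) := LiftingProblem {
  lp_map : vert_cat C;
  lp_cart : hom lp_map m;
  lp_cartP : is_cartesian (vfib C) lp_cart;
  lp_hom : hom lp_map f }.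

Definition lp_index (C : category) (m f : vert_cat C) (P : lifting_problem m f) : C :=
  vbase (lp_map P).
Definition lp_sigma (C : category) (m f : vert_cat C) (P : lifting_problem m f) :
  hom (lp_index P) (vbase m) := hbase (lp_cart P).
Definition lp_tau (C : category) (m f : vert_cat C) (P : lifting_problem m f) :
  hom (lp_index P) (vbase f) := hbase (lp_hom P).

Definition is_solution (C : category) (m f : vert_cat C) (P : lifting_problem m f)
  (j : hom (vcod (lp_map P)) (vdom f)) : Prop :=
  (vproj f ∘ varr f) ∘ j = lp_tau P ∘ vproj (lp_map P) /\
  j ∘ varr (lp_map P) = hdom (lp_hom P) /\
  varr f ∘ j = hcod (lp_hom P).

(** [c] is the canonical map between the two reindexings of [m] lying over [t]. *)
Definition is_universal_lp (C : category) (m f : vert_cat C) (U : lifting_problem m f)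
  : Prop :=
  forall P : lifting_problem m f, exists! t : hom (lp_index P) (lp_index U),
    lp_sigma U ∘ t = lp_sigma P /\
    lp_tau U ∘ t = lp_tau P /\
    exists c : hom (lp_map P) (lp_map U),
      hbase c = t /\ lp_cart U ∘ c = lp_cart P /\ lp_hom U ∘ c = lp_hom P.

(** Both factors are vertical over the base of [f], as [fmid] gets the structure map
    [vproj f ∘ fright]. *)
Record factorisation (C : category) (f : vert_cat C) := Factorisation {
  fmid : C;
  fleft : hom (vdom f) fmid;
  fright : hom fmid (vcod f);
  fright_left : fright ∘ fleft = varr f }.

Section Factors.
Context (C : category) (f : vert_cat C) (K : factorisation f).

Definition Lob : vert_cat C := @VMap C (vbase f) (fmid K) (vdom f)
  (vproj f ∘ fright K) (fleft K).
Definition Rob : vert_cat C := @VMap C (vbase f) (vcod f) (fmid K)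
  (vproj f) (fright K).

Program Definition Lcounit : hom Lob f :=
  @VHom C Lob f (idc _) (fright K) (idc _) _ _.
Next Obligation. now rewrite comp_idl. Qed.
Next Obligation. now rewrite comp_idr, fright_left. Qed.

Program Definition Runit : hom f Rob :=
  @VHom C f Rob (idc _) (idc _) (fleft K) _ _.
Next Obligation. now rewrite comp_idl, comp_idr. Qed.
Next Obligation. now rewrite comp_idl, fright_left. Qed.

End Factors.

Record functorial (C : category) (K : forall f : vert_cat C, factorisation f) :=
  Functorial {
  kmap : forall f g : vert_cat C, hom f g -> hom (fmid (K f)) (fmid (K g));
  kmap_left : forall (f g : vert_cat C) (h : hom f g),
    kmap h ∘ fleft (K f) = fleft (K g) ∘ hdom h;
  kmap_right : forall (f g : vert_cat C) (h : hom f g),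
    fright (K g) ∘ kmap h = hcod h ∘ fright (K f);
  kmap_id : forall f : vert_cat C, kmap (idc f) = idc (fmid (K f));
  kmap_comp : forall (f g k : vert_cat C) (v : hom g k) (u : hom f g),
    kmap (v ∘ u) = kmap v ∘ kmap u }.

Section FactorisationFunctors.
Context (C : category) (K : forall f : vert_cat C, factorisation f) (F : functorial K).

Program Definition Lfun : functor (vert_cat C) (vert_cat C) :=
  @Functor (vert_cat C) (vert_cat C) (fun f => Lob (K f))
    (fun f g h => @VHom C (Lob (K f)) (Lob (K g)) (hbase h) (kmap F h) (hdom h) _ _) _ _.
Next Obligation.
now rewrite <- comp_assoc, kmap_right, comp_assoc, hproj, <- comp_assoc.
Qed.
Next Obligation. now rewrite kmap_left. Qed.
Next Obligation. apply vhom_eq; simpl; trivial; apply kmap_id. Qed.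
Next Obligation. apply vhom_eq; simpl; trivial; apply kmap_comp. Qed.

Program Definition Rfun : functor (vert_cat C) (vert_cat C) :=
  @Functor (vert_cat C) (vert_cat C) (fun f => Rob (K f))
    (fun f g h => @VHom C (Rob (K f)) (Rob (K g)) (hbase h) (hcod h) (kmap F h) _ _) _ _.
Next Obligation. apply hproj. Qed.
Next Obligation. apply kmap_right. Qed.
Next Obligation. apply vhom_eq; simpl; trivial; apply kmap_id. Qed.
Next Obligation. apply vhom_eq; simpl; trivial; apply kmap_comp. Qed.

Definition is_fibred : Prop :=
  forall (f g : vert_cat C) (h : hom f g), is_cartesian (vfib C) h ->
  is_cartesian (vfib C) (fmap Lfun h) /\ is_cartesian (vfib C) (fmap Rfun h).

End FactorisationFunctors.

Record is_comonad (D : category) (L : functor D D) (eps : forall x, hom (L x) x)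
  (del : forall x, hom (L x) (L (L x))) : Prop := {
  cm_eps_nat : forall x y (h : hom x y), eps y ∘ fmap L h = h ∘ eps x;
  cm_del_nat : forall x y (h : hom x y),
    del y ∘ fmap L h = fmap L (fmap L h) ∘ del x;
  cm_counitl : forall x, eps (L x) ∘ del x = idc (L x);
  cm_counitr : forall x, fmap L (eps x) ∘ del x = idc (L x);
  cm_coassoc : forall x, del (L x) ∘ del x = fmap L (del x) ∘ del x }.

Record is_monad (D : category) (R : functor D D) (eta : forall x, hom x (R x))
  (mu : forall x, hom (R (R x)) (R x)) : Prop := {
  m_eta_nat : forall x y (h : hom x y), eta y ∘ h = fmap R h ∘ eta x;
  m_mu_nat : forall x y (h : hom x y), mu y ∘ fmap R (fmap R h) = fmap R h ∘ mu x;
  m_unitl : forall x, mu x ∘ eta (R x) = idc (R x);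
  m_unitr : forall x, mu x ∘ fmap R (eta x) = idc (R x);
  m_assoc : forall x, mu x ∘ mu (R x) = mu x ∘ fmap R (mu x) }.

Record is_distributive_law (D : category) (L R : functor D D)
  (eps : forall x, hom (L x) x) (del : forall x, hom (L x) (L (L x)))
  (eta : forall x, hom x (R x)) (mu : forall x, hom (R (R x)) (R x))
  (dl : forall x, hom (L (R x)) (R (L x))) : Prop := {
  dl_nat : forall x y (h : hom x y),
    dl y ∘ fmap L (fmap R h) = fmap R (fmap L h) ∘ dl x;
  dl_eps : forall x, fmap R (eps x) ∘ dl x = eps (R x);
  dl_eta : forall x, dl x ∘ fmap L (eta x) = eta (L x);
  dl_del : forall x, fmap R (del x) ∘ dl x = dl (L x) ∘ fmap L (dl x) ∘ del (R x);
  dl_mu : forall x, dl x ∘ fmap L (mu x) = mu (L x) ∘ fmap R (dl x) ∘ dl (R x) }.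

(** The comultiplication is over [dom]: its domain component in the arrow category,
    consisting of [hdom] and [hbase], is an identity. *)
Record lawfs (C : category) (K : forall f : vert_cat C, factorisation f) := Lawfs {
  lw_fun :> functorial K;
  lw_comult : forall f : vert_cat C, hom (Lfun lw_fun f) (Lfun lw_fun (Lfun lw_fun f));
  lw_comult_base : forall f, hbase (lw_comult f) = idc (vbase f);
  lw_comult_dom : forall f, hdom (lw_comult f) = idc (vdom f);
  lw_comonad : is_comonad (L := Lfun lw_fun) (fun f => Lcounit (K f)) lw_comult }.

Arguments lw_comult {C K} l f.

Record awfs (C : category) (K : forall f : vert_cat C, factorisation f) := Awfs {
  aw_lawfs :> lawfs K;
  aw_mult : forall f : vert_cat C, hom (Rfun aw_lawfs (Rfun aw_lawfs f)) (Rfun aw_lawfs f);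
  aw_mult_base : forall f, hbase (aw_mult f) = idc (vbase f);
  aw_mult_cod : forall f, hcod (aw_mult f) = idc (vcod f);
  aw_monad : is_monad (R := Rfun aw_lawfs) (fun f => Runit (K f)) aw_mult;
  (* the three equations determine [dl] completely *)
  aw_dist : exists dl : forall f : vert_cat C,
      hom (Lfun aw_lawfs (Rfun aw_lawfs f)) (Rfun aw_lawfs (Lfun aw_lawfs f)),
    (forall f, hbase (dl f) = idc (vbase f) /\
               hdom (dl f) = hcod (lw_comult aw_lawfs f) /\
               hcod (dl f) = hdom (aw_mult f)) /\
    is_distributive_law (L := Lfun aw_lawfs) (R := Rfun aw_lawfs)
      (fun f => Lcounit (K f)) (lw_comult aw_lawfs) (fun f => Runit (K f)) aw_mult dl }.

Arguments aw_mult {C K} a f.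

Section PointedAlgebras.
Context (D : category) (T : functor D D) (eta : forall x, hom x (T x)).

Record palg := PAlg {
  pa_ob : D;
  pa_str : hom (T pa_ob) pa_ob;
  pa_unit : pa_str ∘ eta pa_ob = idc pa_ob }.

Program Definition palg_cat : category :=
  @Category palg
    (fun a b => {h : hom (pa_ob a) (pa_ob b) | h ∘ pa_str a = pa_str b ∘ fmap T h})
    (fun a => idc _) (fun a b c g f => proj1_sig g ∘ proj1_sig f) _ _ _.
Next Obligation. now rewrite fmap_id, comp_idl, comp_idr. Qed.
Next Obligation.
now rewrite fmap_comp, <- comp_assoc, H, comp_assoc, H0, comp_assoc.
Qed.
Next Obligation. apply sig_eq; apply comp_idl. Qed.
Next Obligation. apply sig_eq; apply comp_idr. Qed.
Next Obligation. apply sig_eq; apply comp_assoc. Qed.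

Definition malg_cat (mu : forall x, hom (T (T x)) (T x)) : category :=
  @full_subcat palg_cat (fun a : palg => pa_str a ∘ mu (pa_ob a) = pa_str a ∘ fmap T (pa_str a)).

Definition malg_to_palg (mu : forall x, hom (T (T x)) (T x)) :
  functor (malg_cat mu) palg_cat := full_incl _.

End PointedAlgebras.

Program Definition palg_restr (D : category) (T T' : functor D D)
  (eta : forall x, hom x (T x)) (eta' : forall x, hom x (T' x))
  (phi : forall x, hom (T x) (T' x))
  (phi_nat : forall x y (h : hom x y), phi y ∘ fmap T h = fmap T' h ∘ phi x)
  (phi_unit : forall x, phi x ∘ eta x = eta' x) :
  functor (palg_cat eta') (palg_cat eta) :=
  @Functor (palg_cat eta') (palg_cat eta)
    (fun a => @PAlg D T eta (pa_ob a) (pa_str a ∘ phi (pa_ob a)) _)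
    (fun a b h => proj1_sig h) _ _.
Next Obligation. now rewrite <- comp_assoc, phi_unit, pa_unit. Qed.
Next Obligation.
now rewrite comp_assoc, H, <- !comp_assoc, phi_nat.
Qed.
Next Obligation. now apply sig_eq. Qed.
Next Obligation. now apply sig_eq. Qed.

(** The components are vertical by [fh_right], cf. [factorisation]. *)
Record fact_hom (C : category) (K K' : forall f : vert_cat C, factorisation f)
  (F : functorial K) (F' : functorial K') := FactHom {
  fh_mid :> forall f : vert_cat C, hom (fmid (K f)) (fmid (K' f));
  fh_left : forall f, fh_mid f ∘ fleft (K f) = fleft (K' f);
  fh_right : forall f, fright (K' f) ∘ fh_mid f = fright (K f);
  fh_nat : forall (f g : vert_cat C) (h : hom f g),
    fh_mid g ∘ kmap F h = kmap F' h ∘ fh_mid f }.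

Section FactHomFunctors.
Context (C : category) (K K' : forall f : vert_cat C, factorisation f)
  (F : functorial K) (F' : functorial K') (theta : fact_hom F F').

Program Definition fh_L (f : vert_cat C) : hom (Lfun F f) (Lfun F' f) :=
  @VHom C (Lob (K f)) (Lob (K' f)) (idc _) (theta f) (idc _) _ _.
Next Obligation. now rewrite comp_idl, <- comp_assoc, fh_right. Qed.
Next Obligation. now rewrite comp_idr, fh_left. Qed.

Program Definition fh_R (f : vert_cat C) : hom (Rfun F f) (Rfun F' f) :=
  @VHom C (Rob (K f)) (Rob (K' f)) (idc _) (idc _) (theta f) _ _.
Next Obligation. now rewrite comp_idl, comp_idr. Qed.
Next Obligation. now rewrite comp_idl, fh_right. Qed.

Lemma fh_R_nat (f g : vert_cat C) (h : hom f g) :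
  fh_R g ∘ fmap (Rfun F) h = fmap (Rfun F') h ∘ fh_R f.
Proof. apply vhom_eq; simpl; rewrite ?comp_idl, ?comp_idr; trivial; apply fh_nat. Qed.

Lemma fh_R_unit (f : vert_cat C) : fh_R f ∘ Runit (K f) = Runit (K' f).
Proof. apply vhom_eq; simpl; rewrite ?comp_idl; trivial; apply fh_left. Qed.

End FactHomFunctors.

Record lawfs_hom (C : category) (K K' : forall f : vert_cat C, factorisation f)
  (S : lawfs K) (S' : lawfs K') := LawfsHom {
  lh_fact :> fact_hom S S';
  lh_comult : forall f : vert_cat C,
    lw_comult S' f ∘ fh_L lh_fact f =
    fmap (Lfun S') (fh_L lh_fact f) ∘ fh_L lh_fact (Lfun S f) ∘ lw_comult S f }.

Definition algebraically_free (C : category) (K K' : forall f : vert_cat C, factorisation f)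
  (S : lawfs K) (A : awfs K') (theta : lawfs_hom S A) : Prop :=
  is_cat_iso
    (fcomp (palg_restr (T := Rfun S) (T' := Rfun A) (eta := fun f => Runit (K f))
              (eta' := fun f => Runit (K' f)) (fh_R_nat theta) (fh_R_unit theta))
           (malg_to_palg (T := Rfun A) (fun f => Runit (K' f)) (aw_mult A))).

(** The condition on [k] together with the domain part of [Lcounit _ ∘ k = lp_hom U]
    exhibits [Lob K] as the pushout of [lp_map U] along [hdom (lp_hom U)]. *)
Definition is_step_one_factor (C : category) (m f : vert_cat C) (U : lifting_problem m f)
  (K : factorisation f) (k : hom (lp_map U) (Lob K)) : Prop :=
  is_opcartesian (vdomF C) k /\ Lcounit K ∘ k = lp_hom U.

(** Universal lifting problems and pushouts are unique only up to isomorphism, so a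
    choice of them for every [f] is part of the data. *)
Record step_one (C : category) (m : vert_cat C) := StepOne {
  so_lp : forall f : vert_cat C, lifting_problem m f;
  so_lpP : forall f, is_universal_lp (so_lp f);
  so_fact : forall f : vert_cat C, factorisation f;
  so_k : forall f, hom (lp_map (so_lp f)) (Lob (so_fact f));
  so_kP : forall f, is_step_one_factor (so_k f) }.

Arguments so_lp {C m} s f.
Arguments so_fact {C m} s f.
Arguments so_k {C m} s f.

(** On a map [h : f -> g], [L] is the extension along the opcartesian map [so_k f] of the
    map [s] that the universal property of [so_lp g] assigns to the lifting problem
    [h ∘ lp_hom (so_lp f)]; the comultiplication arises in the same way from viewing
    [so_k f] as a lifting problem against [Lob (so_fact f)]. *)
Definition is_step_one_lawfs (C : category) (m : vert_cat C) (D : step_one m)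
  (S : lawfs (so_fact D)) : Prop :=
  (forall (f g : vert_cat C) (h : hom f g),
     exists s : hom (lp_map (so_lp D f)) (lp_map (so_lp D g)),
       lp_cart (so_lp D g) ∘ s = lp_cart (so_lp D f) /\
       lp_hom (so_lp D g) ∘ s = h ∘ lp_hom (so_lp D f) /\
       fmap (Lfun S) h ∘ so_k D f = so_k D g ∘ s) /\
  (forall f : vert_cat C,
     exists s : hom (lp_map (so_lp D f)) (lp_map (so_lp D (Lfun S f))),
       lp_cart (so_lp D (Lfun S f)) ∘ s = lp_cart (so_lp D f) /\
       lp_hom (so_lp D (Lfun S f)) ∘ s = so_k D f /\
       lw_comult S f ∘ so_k D f = so_k D (Lfun S f) ∘ s).

Definition is_R_algebra (C : category) (f : vert_cat C) (K : factorisation f)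
  (a : hom (Rob K) f) : Prop := a ∘ Runit K = idc f.

(* Main.v *)
(** Dependent products along arbitrary maps drive everything. They represent families of
    squares, hence give the universal lifting problem, and transposing along them shows
    that pushouts are stable under pullback. The laws of step one all follow from two
    uniqueness principles: a map out of [L f] is determined by its effect on [so_k f], and
    a map into the universal lifting problem by the problem it classifies. For a cartesian
    [h : f' -> f], the indexing object of the universal problem of [f'] is the pullback of
    that of [f], so step one is fibred by stability of pushouts.

    If [R'] is algebraically free on [R], then [R' f] is the free algebra on [f] for the
    pointed endofunctor [R]. As [R] is fibred, the reindexing of [R' f] along [h] is an
    algebra and the right adjoint to reindexing lifts to algebras; the reindexing of
    [R' f] is therefore free on [f'], so the comparison from [R' f'] is invertible. *)
From Stdlib Require Import ssreflect ssrfun.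
From Stdlib Require Import ClassicalEpsilon FunctionalExtensionality ProofIrrelevance.
Require Import Defs.

Set Implicit Arguments.
Unset Strict Implicit.
Unset Printing Implicit Defensive.
Set Bullet Behavior "None".

(** * Rewriting composites up to associativity *)

Section Reassoc.
Context (C : category) (w x y z : C) (v : hom w x).

Lemma reassoc1 (g : hom y z) (f : hom x y) (h : hom x z) :
  g ∘ f = h -> g ∘ (f ∘ v) = h ∘ v.
Proof. by move=> <-; rewrite comp_assoc. Qed.

Lemma reassoc2 (u : C) (k : hom y z) (g : hom u y) (f : hom x u) (h : hom x z) :
  k ∘ (g ∘ f) = h -> k ∘ (g ∘ (f ∘ v)) = h ∘ v.
Proof. by move=> <-; rewrite !comp_assoc. Qed.

End Reassoc.

Ltac cassoc := rewrite -?comp_assoc ?comp_idl ?comp_idr.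
(** Composites are kept nested to the right, so an equation for [g ∘ f] or [k ∘ (g ∘ f)] must also
    match in front of a further factor. *)
Ltac rw H :=
  let E := fresh in
  have E := H; move: E; rewrite -?comp_assoc => E;
  first [rewrite E | rewrite (reassoc1 _ E) | rewrite (reassoc2 _ E)];
  clear E; cassoc.

(** * Pullbacks *)

Definition is_pb (C : category) (P A B S : C) (p : hom P A) (q : hom P B)
  (f : hom A S) (g : hom B S) : Prop :=
  f ∘ p = g ∘ q /\
  forall (T : C) (u : hom T A) (v : hom T B), f ∘ u = g ∘ v ->
  exists! w : hom T P, p ∘ w = u /\ q ∘ w = v.

Section Pullbacks.
Context (C : category).

Lemma pb_ext (P A B S : C) (p : hom P A) (q : hom P B) (f : hom A S) (g : hom B S) :
  is_pb p q f g -> forall (T : C) (u v : hom T P),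
  p ∘ u = p ∘ v -> q ∘ u = q ∘ v -> u = v.
Proof.
move=> [sq U] T u v pe qe.
have [|w [_ Hw]] := U T (p ∘ v) (q ∘ v).
  by cassoc; rw sq.
by rewrite -(Hw u) ?(Hw v).
Qed.

Lemma pb_lift (P A B S : C) (p : hom P A) (q : hom P B) (f : hom A S) (g : hom B S) :
  is_pb p q f g -> forall (T : C) (u : hom T A) (v : hom T B),
  f ∘ u = g ∘ v -> exists w : hom T P, p ∘ w = u /\ q ∘ w = v.
Proof. by move=> [_ U] T u v /U [w [H _]]; exists w. Qed.

Lemma pb_sym (P A B S : C) (p : hom P A) (q : hom P B) (f : hom A S) (g : hom B S) :
  is_pb p q f g -> is_pb q p g f.
Proof.
move=> [sq U]; split=> // T u v E.
have [w [[H1 H2] Hw]] := U T v u (esym E).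
by exists w; split=> // w' [? ?]; apply: Hw.
Qed.

Lemma pb_intro (P A B S : C) (p : hom P A) (q : hom P B) (f : hom A S) (g : hom B S) :
  f ∘ p = g ∘ q ->
  (forall (T : C) (u : hom T A) (v : hom T B), f ∘ u = g ∘ v ->
    exists w : hom T P, p ∘ w = u /\ q ∘ w = v) ->
  (forall (T : C) (u v : hom T P), p ∘ u = p ∘ v -> q ∘ u = q ∘ v -> u = v) ->
  is_pb p q f g.
Proof.
move=> sq ex un; split=> // T u v /ex [w [H1 H2]].
by exists w; split=> // w' [H3 H4]; apply: un; rewrite ?H1 ?H2.
Qed.

Lemma pb_paste (P A B S Q D : C) (p : hom P A) (q : hom P B) (f : hom A S)
  (g : hom B S) (p' : hom Q P) (q' : hom Q D) (h : hom D B) :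
  is_pb p q f g -> is_pb p' q' q h -> is_pb (p ∘ p') q' f (g ∘ h).
Proof.
move=> H1 H2; apply: pb_intro.
- by rewrite comp_assoc (proj1 H1); cassoc; rw (proj1 H2).
- move=> T u v; cassoc=> E.
  have [w [w1 w2]] := pb_lift H1 E.
  have [x [x1 x2]] := pb_lift H2 w2.
  by exists x; split=> //; cassoc; rewrite x1.
- move=> T u v; cassoc=> E1 E2.
  apply: (pb_ext H2) => //; apply: (pb_ext H1) => //.
  by rw (proj1 H2); rewrite E2; rw (proj1 H2).
Qed.

Lemma pb_cancel (P A B S Q D : C) (p : hom P A) (q : hom P B) (f : hom A S)
  (g : hom B S) (p' : hom Q P) (q' : hom Q D) (h : hom D B) :
  is_pb p q f g -> q ∘ p' = h ∘ q' -> is_pb (p ∘ p') q' f (g ∘ h) ->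
  is_pb p' q' q h.
Proof.
move=> H1 sq H2; apply: pb_intro => //.
- move=> T u v E.
  have [|w [w1 w2]] := pb_lift H2 (u := p ∘ u) (v := v).
    by rw (proj1 H1); rewrite E.
  exists w; split=> //; apply: (pb_ext H1); first by rewrite comp_assoc.
  by rw sq; rewrite w2 E.
- move=> T u v E1 E2; apply: (pb_ext H2) => //; cassoc.
  by rewrite E1.
Qed.

Lemma pb_id (A S : C) (f : hom A S) : is_pb (idc A) f f (idc S).
Proof.
apply: pb_intro; first by rewrite comp_idl comp_idr.
- by move=> T u v; rewrite comp_idl => E; exists u; rewrite comp_idl.
- by move=> T u v; rewrite !comp_idl.
Qed.

Lemma pb_iso (P P' A B S : C) (p : hom P A) (q : hom P B) (p' : hom P' A)
  (q' : hom P' B) (f : hom A S) (g : hom B S) (i : hom P' P) (j : hom P P') :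
  is_pb p q f g -> i ∘ j = idc P -> j ∘ i = idc P' -> p ∘ i = p' -> q ∘ i = q' ->
  is_pb p' q' f g.
Proof.
move=> H ij ji <- <-; apply: pb_intro.
- by rw (proj1 H).
- move=> T u v E; have [w [w1 w2]] := pb_lift H E.
  by exists (j ∘ w); split; cassoc; rw ij.
- move=> T u v; cassoc=> E1 E2.
  have E : i ∘ u = i ∘ v by apply: (pb_ext H).
  by rewrite -(comp_idl u) -(comp_idl v) -ji; cassoc; rewrite E.
Qed.

End Pullbacks.

(** * Pullbacks, exponentials and dependent products from slices *)

Section Slices.
Context (C : category) (C_lccc : is_lccc C).

Definition sob (I A : C) (a : hom A I) : slice I := existT (fun x => hom x I) A a.
Definition shom (I A B : C) (a : hom A I) (b : hom B I) (f : hom A B)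
  (H : b ∘ f = a) : @hom (slice I) (sob a) (sob b) := exist _ f H.

(** This turns the products in [is_exponential] into squares of [C]. From left to right, a cone on
    [T] becomes a test object of the slice by composing it down to [I]. *)
Lemma slice_product_pb (I : C) (a b p : slice I) (p1 : hom p a) (p2 : hom p b) :
  is_product p1 p2 <->
  is_pb (proj1_sig p1) (proj1_sig p2) (projT2 a) (projT2 b).
Proof.
move: a b p p1 p2 => [A a] [B b] [P p] [p1 e1] [p2 e2] /=; simpl in *.
split=> H.
- apply: pb_intro; first by rewrite e1 e2.
  + move=> T u v E.
    have [w [[w1 w2] _]] := H (sob (a ∘ u)) (shom erefl) (shom (esym E)).
    by exists (proj1_sig w); split; [apply: (f_equal (@proj1_sig _ _) w1) |
      apply: (f_equal (@proj1_sig _ _) w2)].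
  + move=> T u v E1 E2.
    have Hu : p ∘ u = p ∘ v by rewrite -e1; cassoc; rewrite E1.
    have F1 : a ∘ (p1 ∘ v) = p ∘ v by rewrite comp_assoc e1.
    have F2 : b ∘ (p2 ∘ v) = p ∘ v by rewrite comp_assoc e2.
    have [w [_ Hw]] := H (sob (p ∘ v)) (shom F1) (shom F2).
    have Ev := Hw (@shom _ _ _ _ p v erefl).
    have Eu := Hw (@shom _ _ _ _ p u Hu).
    have -> : u = proj1_sig w.
      by rewrite Eu //; split; apply: sig_eq.
    by rewrite Ev //; split; apply: sig_eq.
- move=> [X x] [u Hu] [v Hv]; simpl in *.
  have [|w [[w1 w2] Hw]] := proj2 H X u v; first by rewrite Hu Hv.
  have Hx : p ∘ w = x by rewrite -e1; cassoc; rewrite w1.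
  exists (exist _ w Hx); split.
    by split; apply: sig_eq.
  move=> [w' Hw'] [/= E1 E2]; apply: sig_eq => /=; apply: Hw.
  by split; [apply: (f_equal (@proj1_sig _ _) E1) |
      apply: (f_equal (@proj1_sig _ _) E2)].
Qed.

Lemma pb_exists (A B S : C) (f : hom A S) (g : hom B S) :
  exists (P : C) (p : hom P A) (q : hom P B), is_pb p q f g.
Proof.
have [_ [pr _]] := C_lccc S.
have [P [p [q /slice_product_pb H]]] := pr (sob f) (sob g).
by exists (projT1 P), (proj1_sig p), (proj1_sig q).
Qed.

(** This is the exponential of [slice I] unwound: [E] represents maps over [I] to [B] out of
    pullbacks of [a], tested on every pullback square so that no choice of pullbacks enters. *)
Lemma local_exponential (A B I : C) (a : hom A I) (b : hom B I) :
  exists (E P : C) (sE : hom E I) (p1 : hom P E) (p2 : hom P A) (ev : hom P B),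
    is_pb p1 p2 sE a /\ b ∘ ev = sE ∘ p1 /\
    forall (K Q : C) (s : hom K I) (q1 : hom Q K) (q2 : hom Q A) (e : hom Q B),
      is_pb q1 q2 s a -> b ∘ e = s ∘ q1 ->
      exists! g : hom K E, sE ∘ g = s /\
        exists u : hom Q P, p1 ∘ u = g ∘ q1 /\ p2 ∘ u = q2 /\ ev ∘ u = e.
Proof.
have [_ [_ ex]] := C_lccc I.
have [[E sE] [[P sP] [[p1 H1] [[p2 H2] [[ev Hev] [/slice_product_pb /= pr U]]]]]] :=
  ex (sob a) (sob b).
simpl in *.
exists E, P, sE, p1, p2, ev; split=> //; split; first by rewrite Hev H1.
move=> K Q s q1 q2 e Hpb He.
have Hq2 : a ∘ q2 = s ∘ q1 by rewrite (proj1 Hpb).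
have Hq : is_product (C := slice I) (p := sob (s ∘ q1)) (a := sob s) (b := sob a)
   (shom erefl) (shom Hq2) by apply/slice_product_pb.
have [[g Hg] [[[u Hu] [/= u1 [u2 u3]]] gU]] := U (sob s) _ _ _ Hq (@shom _ _ _ _ b e He).
simpl in *.
exists g; split.
  split=> //; exists u; split; first by apply: (f_equal (@proj1_sig _ _) u1).
  by split; [apply: (f_equal (@proj1_sig _ _) u2) | apply: (f_equal (@proj1_sig _ _) u3)].
move=> g' [Hg' [u' [u1' [u2' u3']]]].
have Hu' : sP ∘ u' = s ∘ q1 by rewrite -H1; cassoc; rewrite u1'; rw Hg'.
apply: (f_equal (@proj1_sig _ _) (gU (exist _ g' Hg') _)).
by exists (exist _ u' Hu'); split; [|split]; apply: sig_eq.
Qed.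

(** [E] represents the sections of [g] over the pullbacks of [a]: it is the dependent
    product of [g] along [a], with its universal property in pullback-stable form. *)
Lemma dependent_product (I A G : C) (a : hom A I) (g : hom G A) :
  exists (E P : C) (sE : hom E I) (p1 : hom P E) (p2 : hom P A) (ev : hom P G),
    is_pb p1 p2 sE a /\ g ∘ ev = p2 /\
    forall (K Q : C) (s : hom K I) (q1 : hom Q K) (q2 : hom Q A) (e : hom Q G),
      is_pb q1 q2 s a -> g ∘ e = q2 ->
      exists! h : hom K E, sE ∘ h = s /\
        exists u : hom Q P, p1 ∘ u = h ∘ q1 /\ p2 ∘ u = q2 /\ ev ∘ u = e.
Proof.
have [E1 [P1 [s1 [p1 [k1 [ev1 [pb1 [He1 U1]]]]]]]] := local_exponential a (a ∘ g).
have [E2 [P2 [s2 [p2 [k2 [ev2 [pb2 [He2 U2]]]]]]]] := local_exponential a a.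
(* [n] is postcomposition with [g], from the exponential of [a ∘ g] by [a] to that of [a] by [a];
   [i] below names the identity of [a]. Their pullback cuts out the sections of [g]. *)
have [|n [[sn [vn [n1 [n2 n3]]]] _]] := U2 E1 P1 s1 p1 k1 (g ∘ ev1) pb1.
  by rewrite comp_assoc.
have [|i [[si [vi [i1 [i2 i3]]]] _]] := U2 I A (idc I) a (idc A) (idc A) (pb_sym (pb_id a)).
  by rewrite comp_idl comp_idr.
have [E [iota [sE pbE]]] := pb_exists n i.
have sE1 : s1 ∘ iota = sE by rewrite -sn; cassoc; rewrite (proj1 pbE); rw si.
have [P [pp [kk pbP]]] := pb_exists sE a.
have [|w [w1 w2]] := pb_lift pb1 (u := iota ∘ pp) (v := kk).
  by rewrite comp_assoc sE1; apply: (proj1 pbP).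
exists E, P, sE, pp, kk, (ev1 ∘ w); split=> //; split.
  have E0 : vn ∘ w = vi ∘ kk.
    apply: (pb_ext pb2); last by rw n2; rewrite w2; rw i2.
    by rw n1; rewrite w1; rw (proj1 pbE); rewrite (proj1 pbP); rw i1.
  by rw (esym n3); rewrite E0; rw i3.
move=> K Q s q1 q2 e Hpb He.
have [|h1 [[sh [u [u1 [u2 u3]]]] Uh]] := U1 K Q s q1 q2 e Hpb.
  by cassoc; rewrite He (proj1 Hpb).
(* Both composites classify [q2] as a map over [I] into [A]. *)
have Hn : n ∘ h1 = i ∘ s.
  have [|x [_ Ux]] := U2 K Q s q1 q2 q2 Hpb; first by rewrite (proj1 Hpb).
  transitivity x; [symmetry|]; apply: Ux.
  - split; first by rw sn.
    exists (vn ∘ u); split; first by rw n1; rewrite u1.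
    split; first by rw n2.
    by rw n3; rewrite u3.
  - split; first by rw si.
    exists (vi ∘ q2); split; first by rw i1; rewrite (proj1 Hpb).
    by split; [rw i2 | rw i3].
have [h [hE1 hE2]] := pb_lift pbE Hn.
exists h; split.
  split=> //.
  have [|v [v1 v2]] := pb_lift pbP (u := h ∘ q1) (v := q2).
    by rw hE2; rewrite (proj1 Hpb).
  exists v; split=> //; split=> //.
  have Hwv : w ∘ v = u.
    apply: (pb_ext pb1); last by rw w2; rewrite u2.
    by rw w1; rewrite v1; rw hE1; rewrite u1.
  by cassoc; rewrite Hwv.
move=> h' [sh' [v [v1 [v2 v3]]]].
apply: (pb_ext pbE); last by rewrite hE2.
rewrite hE1; apply: Uh; split; first by rw sE1.
exists (w ∘ v); split; first by rw w1; rewrite v1.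
split; first by rw w2.
by rewrite -v3; cassoc.
Qed.

Lemma terminal_exists : has_finite_limits C -> exists x : C, is_terminal x.
Proof.
move=> lim.
pose J := @Category Empty_set (fun _ _ => Empty_set) (fun x => match x with end)
  (fun x => match x with end) (fun x => match x with end) (fun x => match x with end)
  (fun x => match x with end).
have D : functor J C by unshelve eexists; case.
have [|x [p [_ U]]] := lim J D.
  by split; [exists nil; case | case].
exists x => y.
have [|u [_ Hu]] := U y (fun i => match i with end); first by case.
by exists u; split=> // v _; apply: Hu; case.
Qed.

Lemma product_exists : has_finite_limits C -> forall I J : C,
  exists (B : C) (p : hom B I) (q : hom B J), is_product p q.
Proof.
move=> /terminal_exists [t Ht] I J.
have [f _] := Ht I; have [g _] := Ht J.
have [B [p [q H]]] := pb_exists f g.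
exists B, p, q => X u v; apply: (proj2 H).
have [z [_ Hz]] := Ht X; by rewrite -(Hz (f ∘ u)) // -(Hz (g ∘ v)).
Qed.

End Slices.

(** * The fibration of vertical maps *)

Section Cartesian.
Context (C : category).
Implicit Types f g z : vert_cat C.

(** The concrete form of cartesianness: codomain and domain are both reindexed by pullback. The
    equivalence is [vpb_cartesian] together with [cartesian_vpb]. *)
Definition is_vpb f g (h : hom f g) : Prop :=
  is_pb (hcod h) (vproj f) (vproj g) (hbase h) /\
  is_pb (hdom h) (vproj f ∘ varr f) (vproj g ∘ varr g) (hbase h).

Lemma vpb_cartesian f g (h : hom f g) : is_vpb h -> is_cartesian (vfib C) h.
Proof.
move=> [Hc Hd] z k t /= Ht.
have [|lc [c1 c2]] := pb_lift Hc (u := hcod k) (v := t ∘ vproj z).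
  by rewrite (hproj k) comp_assoc Ht.
have [|ld [d1 d2]] := pb_lift Hd (u := hdom k) (v := t ∘ vproj z ∘ varr z).
  by rw (hsquare k); rw (hproj k); rewrite -Ht; cassoc.
have Hs : varr f ∘ ld = lc ∘ varr z.
  apply: (pb_ext Hc); first by rw (esym (hsquare h)); rewrite d1 (hsquare k); rw c1.
  by move: d2; cassoc=> ->; rw c2.
exists (@VHom C z f t lc ld c2 Hs); split; first by split=> //; apply: vhom_eq.
move=> l [/= lb lh]; apply: vhom_eq => //=.
- apply: (pb_ext Hc); first by rewrite c1 -lh.
  by rewrite c2 (hproj l) lb.
- apply: (pb_ext Hd); first by rewrite d1 -lh.
  by rewrite d2; cassoc; rewrite (hsquare l); rw (hproj l); rewrite lb.
Qed.

Lemma cartesian_ext f g (h : hom f g) : is_cartesian (vfib C) h ->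
  forall z (u v : hom z f), hbase u = hbase v -> h ∘ u = h ∘ v -> u = v.
Proof.
move=> H z u v Eb Eh.
have [|w [_ Hw]] := H z (h ∘ v) (hbase v); first by [].
by rewrite -(Hw u) // -(Hw v).
Qed.

Lemma cartesian_lift f g (h : hom f g) : is_cartesian (vfib C) h ->
  forall z (k : hom z g) (t : hom (vbase z) (vbase f)), hbase h ∘ t = hbase k ->
  exists l : hom z f, hbase l = t /\ h ∘ l = k.
Proof. by move=> H z k t /H [l [Hl _]]; exists l. Qed.

Lemma cartesian_comp f g z (k : hom g z) (h : hom f g) :
  is_cartesian (vfib C) k -> is_cartesian (vfib C) h -> is_cartesian (vfib C) (k ∘ h).
Proof.
move=> Hk Hh w u t; rewrite fmap_comp -comp_assoc => E.
have [l1 [b1 e1]] := cartesian_lift Hk E.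
have [l [b e]] := cartesian_lift Hh (esym b1).
exists l; split; first by split=> //; rewrite -comp_assoc e.
move=> l' [b' e']; apply: (cartesian_ext Hh); first by rewrite b -b'.
rewrite e; apply: (cartesian_ext Hk); first by rewrite b1 -[t]b'.
by rewrite e1 -e' comp_assoc.
Qed.

Lemma cartesian_cancel f g z (k : hom g z) (h : hom f g) :
  is_cartesian (vfib C) k -> is_cartesian (vfib C) (k ∘ h) -> is_cartesian (vfib C) h.
Proof.
move=> Hk Hkh w u t E.
have [|l [b e]] := cartesian_lift Hkh (k := k ∘ u) (t := t).
  by rewrite /= -comp_assoc -[hbase u]E.
have e' : h ∘ l = u.
  apply: (cartesian_ext Hk); last by rewrite comp_assoc.
  by rewrite -[hbase u]E -[t]b.
exists l; split=> // l' [b' e1]; apply: (cartesian_ext Hkh).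
  by rewrite b -[t]b'.
by rewrite -!comp_assoc e1 e'.
Qed.

Lemma iso_cartesian f g (h : hom f g) (h' : hom g f) :
  h ∘ h' = idc g -> h' ∘ h = idc f -> is_cartesian (vfib C) h.
Proof.
move=> E E' z k t Et; exists (h' ∘ k); split.
  split; last by rewrite comp_assoc E comp_idl.
  rewrite /= -[hbase k]Et; have /= := f_equal (fun l : vhom _ _ => hbase l) E'.
  by rewrite comp_assoc => ->; rewrite comp_idl.
by move=> l [_ <-]; rewrite comp_assoc E' comp_idl.
Qed.


Section Lifts.
Context (C_lccc : is_lccc C).

Lemma vpb_exists g (K : C) (t : hom K (vbase g)) :
  exists (c d : C) (p : hom c K) (a : hom d c) (h : @hom (vert_cat C) (VMap p a) g),
    hbase h = t /\ is_vpb h.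
Proof.
have [c [hc [p Hc]]] := pb_exists C_lccc (vproj g) t.
have [d [hd [p' Hd]]] := pb_exists C_lccc (vproj g ∘ varr g) t.
have [|a [a1 a2]] := pb_lift Hc (u := varr g ∘ hd) (v := p').
  by rewrite -(proj1 Hd); cassoc.
exists c, d, p, a, (@VHom C (VMap p a) g t hc hd (proj1 Hc) (esym a1)).
by split=> //; split=> //=; rewrite a2.
Qed.

(** The map [h] is compared with the explicit lift from [vpb_exists] over the same base map.
    Cartesian lifts are isomorphic, and pullback squares transfer along isomorphisms. *)
Lemma cartesian_vpb f g (h : hom f g) : is_cartesian (vfib C) h -> is_vpb h.
Proof.
move=> H.
have [c [d [p [a [k [kb Hk]]]]]] := vpb_exists (hbase h).
have Hk' := vpb_cartesian Hk.
have [|l [lb le]] := cartesian_lift H (k := k) (t := idc _).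
  by rewrite comp_idr kb.
have [|n [nb ne]] := cartesian_lift Hk' (k := h) (t := idc _).
  by rewrite comp_idr kb.
have E1 : l ∘ n = idc f.
  apply: (cartesian_ext H); last by rewrite comp_assoc le ne comp_idr.
  by rewrite /= lb nb comp_idl.
have E2 : n ∘ l = idc _.
  apply: (cartesian_ext Hk'); last by rewrite comp_assoc ne le comp_idr.
  by rewrite /= lb nb comp_idl.
move: Hk => [Hc Hd]; rewrite kb in Hc Hd; split.
- apply: (pb_iso (i := hcod n) (j := hcod l) Hc).
  + by have /= := f_equal (fun l : vhom _ _ => hcod l) E2.
  + by have /= := f_equal (fun l : vhom _ _ => hcod l) E1.
  + by have /= := f_equal (fun l : vhom _ _ => hcod l) ne.
  + by have := hproj n; rewrite nb comp_idl.
- apply: (pb_iso (i := hdom n) (j := hdom l) Hd).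
  + by have /= := f_equal (fun l : vhom _ _ => hdom l) E2.
  + by have /= := f_equal (fun l : vhom _ _ => hdom l) E1.
  + by have /= := f_equal (fun l : vhom _ _ => hdom l) ne.
  + by cassoc; rw (hsquare n); rw (hproj n); rewrite nb comp_idl.
Qed.

(** The domain component of [L h] is that of [h], and its codomain component is the domain component
    of [R h]; so both squares for [L h] occur among those for [h] and [R h]. *)
Lemma is_fibred_of_R (K : forall f, factorisation f) (F : functorial K) :
  (forall f g (h : hom f g), is_cartesian (vfib C) h ->
    is_cartesian (vfib C) (fmap (Rfun F) h)) -> is_fibred F.
Proof.
move=> H f g h Hh; have Hr := H f g h Hh; split=> //.
have [_ Hd] := cartesian_vpb Hh; have [_ /= Hk] := cartesian_vpb Hr.
apply: vpb_cartesian; split=> //=.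
by rewrite -!comp_assoc !fright_left.
Qed.

End Lifts.
End Cartesian.

(** * Universal lifting problems *)

Section UniversalLifting.
Context (C : category).

Lemma product_ext (A B P : C) (p : hom P A) (q : hom P B) :
  is_product p q -> forall (T : C) (u v : hom T P),
  p ∘ u = p ∘ v -> q ∘ u = q ∘ v -> u = v.
Proof.
move=> H T u v E1 E2; have [w [_ Hw]] := H T (p ∘ v) (q ∘ v).
by rewrite -(Hw u) ?(Hw v).
Qed.

Context (C_lccc : is_lccc C) (C_lim : has_finite_limits C).

(** The dependent product is taken over [I × J], along [V × J -> I × J]. *)
Lemma universal_map (I J V Y : C) (a : hom V I) (y : hom Y J) :
  exists (E P : C) (s : hom E I) (t : hom E J) (p1 : hom P E) (p2 : hom P V)
    (e : hom P Y), is_pb p1 p2 s a /\ y ∘ e = t ∘ p1 /\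
    forall (K Q : C) (s' : hom K I) (t' : hom K J) (q1 : hom Q K) (q2 : hom Q V)
      (e' : hom Q Y), is_pb q1 q2 s' a -> y ∘ e' = t' ∘ q1 ->
      exists! u : hom K E, s ∘ u = s' /\ t ∘ u = t' /\
        exists v : hom Q P, p1 ∘ v = u ∘ q1 /\ p2 ∘ v = q2 /\ e ∘ v = e'.
Proof.
have [B [b1 [b2 HB]]] := product_exists C_lccc C_lim I J.
have [VB [beta [nu HV]]] := pb_exists C_lccc b1 a.
(* [G] is [Y] pulled back to [VB], the product of [V] and [J]: a section of [g] along a map into
   [VB] is a map to [Y] over [J]. *)
have [G [g [gamma HG]]] := pb_exists C_lccc (b2 ∘ beta) y.
have [E [P [sE [p1 [p2 [ev [HP [Hev U]]]]]]]] := dependent_product C_lccc beta g.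
exists E, P, (b1 ∘ sE), (b2 ∘ sE), p1, (nu ∘ p2), (gamma ∘ ev); split.
  by apply: pb_sym; apply: pb_paste (pb_sym HV) (pb_sym HP).
split.
  by rw (esym (proj1 HG)); rw Hev; rw (proj1 HP).
move=> K Q s' t' q1 q2 e' HQ He'.
have [bK [[bK1 bK2] _]] := HB K s' t'.
have [|r [r1 r2]] := pb_lift HV (u := bK ∘ q1) (v := q2).
  by rw bK1; rewrite (proj1 HQ).
have Hr : is_pb q1 r bK beta.
  apply: pb_sym; apply: (pb_cancel (pb_sym HV)) => //.
  by rewrite r2 bK1; apply: pb_sym.
have [|d [d1 d2]] := pb_lift HG (u := r) (v := e').
  by cassoc; rewrite r1; rw bK2.
have [h [[h1 [u [u1 [u2 u3]]]] Uh]] := U K Q bK q1 r d Hr d1.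
exists h; split.
  split; first by rw h1.
  split; first by rw h1.
  exists u; split=> //; split; first by rw u2.
  by rw u3.
move=> h' [s1 [t1 [v [v1 [v2 v3]]]]]; apply: Uh.
have E1 : sE ∘ h' = bK.
  by apply: (product_ext HB); rewrite comp_assoc ?bK1 ?bK2.
have E2 : p2 ∘ v = r.
  apply: (pb_ext HV); last by rewrite comp_assoc r2.
  by rewrite r1 -E1; rw (esym (proj1 HP)); rewrite v1.
split=> //; exists v; split=> //; split=> //.
apply: (pb_ext HG); last by rewrite comp_assoc d2.
by rw Hev; rewrite E2.
Qed.

(** Squares are represented in two stages. [E] represents their codomain components. Given one of
    these, a domain component is a lift through [varr f], that is, a section of [w], and these are
    represented over [E] by the dependent product [H] along [p1 ∘ al]. *)
Lemma universal_lp_exists (m f : vert_cat C) :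
  exists U : lifting_problem m f, is_universal_lp U.
Proof.
have [E [P [s [t [p1 [p2 [e [HP [He UE]]]]]]]]] := universal_map (vproj m) (vproj f).
have [A [al [mu HA]]] := pb_exists C_lccc p2 (varr m).
have [W [w [chi HW]]] := pb_exists C_lccc (e ∘ al) (varr f).
have [H [Q [sH [q1 [q2 [ev [HQ [Hev UH]]]]]]]] := dependent_product C_lccc (p1 ∘ al) w.
(* Over [H], the reindexing of [m] has codomain [Z], domain [Q] and underlying map [b]. *)
have [Z [z1 [z2 HZ]]] := pb_exists C_lccc sH p1.
have [|b [b1 b2]] := pb_lift HZ (u := q1) (v := al ∘ q2).
  by rewrite (proj1 HQ) -comp_assoc.
have pc : vproj m ∘ (p2 ∘ z2) = s ∘ sH ∘ z1.
  by rw (esym (proj1 HP)); rewrite (proj1 HZ).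
have pd : varr m ∘ (mu ∘ q2) = p2 ∘ z2 ∘ b.
  by rw (esym (proj1 HA)); rewrite b2.
have hc : vproj f ∘ (e ∘ z2) = t ∘ sH ∘ z1.
  by rw He; rewrite -(proj1 HZ).
have hd : varr f ∘ (chi ∘ ev) = e ∘ z2 ∘ b.
  by rw (esym (proj1 HW)); rw Hev; rewrite b2.
pose M : vert_cat C := VMap z1 b.
pose cart : hom M m := @VHom C M m (s ∘ sH) (p2 ∘ z2) (mu ∘ q2) pc pd.
have cartP : is_vpb cart.
  split; rewrite /cart /=.
  - exact: pb_paste (pb_sym HP) (pb_sym HZ).
  - rewrite b1; apply: (pb_paste (q := p1 ∘ al)); last exact: pb_sym.
    exact: pb_sym (pb_paste HP HA).
pose U : lifting_problem m f :=
  LiftingProblem (vpb_cartesian cartP) (@VHom C M f (t ∘ sH) (e ∘ z2) (chi ∘ ev) hc hd).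
exists U => -[N k Hk h].
have [Nc Nd] := cartesian_vpb C_lccc Hk.
have [|u [[u1 [u2 [v [v1 [v2 v3]]]]] Uu]] :=
  UE _ _ (hbase k) (hbase h) (vproj N) (hcod k) (hcod h) (pb_sym Nc).
  exact: hproj.
have [|r [r1 r2]] := pb_lift HA (u := v ∘ varr N) (v := hdom k).
  by rw v2; rewrite (hsquare k).
have [|x [x1 x2]] := pb_lift HW (u := r) (v := hdom h).
  by cassoc; rewrite r1; rw v3; rewrite (hsquare h).
have Hr : is_pb (vproj N ∘ varr N) r u (p1 ∘ al).
  apply: pb_sym; apply: (pb_cancel (pb_sym (pb_paste HP HA))).
  - by cassoc; rewrite r1; rw v1.
  - by rewrite r2 u1.
have [g [[g1 [y [y1 [y2 y3]]]] Ug]] := UH _ _ u _ r x Hr x1.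
have [|yc [yc1 yc2]] := pb_lift HZ (u := g ∘ vproj N) (v := v).
  by rw g1; rewrite v1.
have Hc : b ∘ y = yc ∘ varr N.
  apply: (pb_ext HZ); first by rw b1; rw yc1; rewrite y1.
  by rw b2; rewrite y2 r1; rw yc2.
exists g; rewrite /lp_sigma /lp_tau /=; split.
  split; first by rw g1.
  split; first by rw g1.
  exists (@VHom C N M g yc y yc1 Hc); split=> //; split; apply: vhom_eq => /=.
  - by rw g1.
  - by rw yc2; rewrite v2.
  - by cassoc; rewrite y2.
  - by rw g1.
  - by rw yc2; rewrite v3.
  - by cassoc; rewrite y3.
move=> g' [s1 [t1 [c [cb [ck ch]]]]]; apply: Ug.
have kc : p2 ∘ z2 ∘ hcod c = hcod k := f_equal (fun l : vhom _ _ => hcod l) ck.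
have hc' : e ∘ z2 ∘ hcod c = hcod h := f_equal (fun l : vhom _ _ => hcod l) ch.
have kd : mu ∘ q2 ∘ hdom c = hdom k := f_equal (fun l : vhom _ _ => hdom l) ck.
have hd' : chi ∘ ev ∘ hdom c = hdom h := f_equal (fun l : vhom _ _ => hdom l) ch.
have cp : z1 ∘ hcod c = g' ∘ vproj N by rewrite -cb; exact: (hproj c).
have cs : b ∘ hdom c = hcod c ∘ varr N := hsquare c.
(* Uniqueness follows the same two stages: the codomain component of [c] fixes the image in [E], and
   then its domain component fixes the section. *)
have Eu : sH ∘ g' = u.
  symmetry; apply: Uu; split; first by rewrite comp_assoc.
  split; first by rewrite comp_assoc.
  exists (z2 ∘ hcod c); split; first by rw (esym (proj1 HZ)); rw cp.
  by rewrite !comp_assoc.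
have Ev : z2 ∘ hcod c = v.
  apply: (pb_ext HP); last by rewrite comp_assoc kc v2.
  by rw (esym (proj1 HZ)); rewrite v1 -Eu; rw cp.
have Er : q2 ∘ hdom c = r.
  apply: (pb_ext HA); last by rewrite comp_assoc kd r2.
  by rewrite r1 -Ev; rw (esym b2); rewrite cs; cassoc.
split=> //; exists (hdom c); split; first by rw (esym b1); rewrite cs; rw cp.
split=> //; apply: (pb_ext HW); first by rw Hev; rewrite Er x1.
by rewrite comp_assoc hd' x2.
Qed.

End UniversalLifting.

(** * Step one *)

Section StepOneFactor.
Context (C : category).
Implicit Types f g z : vert_cat C.

Lemma opcartesian_ext (A B : category) (P : functor A B) (x y : A) (k : hom x y) :
  is_opcartesian P k -> forall (z : A) (u v : hom y z),
  fmap P u = fmap P v -> u ∘ k = v ∘ k -> u = v.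
Proof.
move=> H z u v E1 E2; have [|w [_ Hw]] := H z (v ∘ k) (fmap P v).
  by rewrite fmap_comp.
by rewrite -(Hw u) // -(Hw v).
Qed.

Lemma pushout_ext (a b c d : C) (f : hom a b) (g : hom a c) (i : hom b d) (j : hom c d) :
  is_pushout f g i j -> forall (x : C) (u v : hom d x),
  u ∘ i = v ∘ i -> u ∘ j = v ∘ j -> u = v.
Proof.
move=> [sq U] x u v E1 E2; have [|w [_ Hw]] := U x (v ∘ i) (v ∘ j).
  by rewrite -!comp_assoc sq.
by rewrite -(Hw u) // -(Hw v).
Qed.

Lemma pushout_desc (a b c d : C) (f : hom a b) (g : hom a c) (i : hom b d) (j : hom c d) :
  is_pushout f g i j -> forall (x : C) (u : hom b x) (v : hom c x), u ∘ f = v ∘ g ->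
  exists w : hom d x, w ∘ i = u /\ w ∘ j = v.
Proof. by move=> [_ U] x u v /U [w [Hw _]]; exists w. Qed.

(** The map [t] prescribes the base and domain components of an extension. Only the codomain
    component is left, and the pushout supplies it. *)
Lemma pushout_opcartesian f g (k : hom f g) :
  is_pushout (hdom k) (varr f) (varr g) (hcod k) -> is_opcartesian (vdomF C) k.
Proof.
move=> H z l t Et.
have Ed : atop t ∘ hdom k = hdom l := f_equal (fun x : arr_hom _ _ => atop x) Et.
have Eb : abot t ∘ hbase k = hbase l := f_equal (fun x : arr_hom _ _ => abot x) Et.
have Es : vproj z ∘ varr z ∘ atop t = abot t ∘ (vproj g ∘ varr g) := asquare t.
have [|w [w1 w2]] := pushout_desc H (u := varr z ∘ atop t) (v := hcod l).
  by cassoc; rewrite Ed (hsquare l).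
have Hp : vproj z ∘ w = abot t ∘ vproj g.
  apply: (pushout_ext H); first by move: Es; cassoc; rewrite w1 => ->.
  by cassoc; rewrite w2 (hproj k) (hproj l) comp_assoc Eb.
exists (@VHom C g z (abot t) w (atop t) Hp (esym w1)); split.
  by split; [apply: arr_hom_eq | apply: vhom_eq].
move=> n [E1 E2]; apply: vhom_eq => /=.
- by rewrite -E1.
- apply: (pushout_ext H); first by rewrite w1 -(hsquare n) -E1.
  by rewrite w2 -E2.
- by rewrite -E1.
Qed.

(** Test objects over the terminal object see all of [C]. *)
Lemma opcartesian_pushout f g (k : hom f g) (one : C) : is_terminal one ->
  is_opcartesian (vdomF C) k -> is_pushout (hdom k) (varr f) (varr g) (hcod k).
Proof.
move=> Hone H.
have bang (y : C) (u v : hom y one) : u = v.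
  by have [w [_ Hw]] := Hone y; rewrite -(Hw u) // -(Hw v).
split; first exact: hsquare.
move=> x u v E.
have [bx _] := Hone x; have [bf _] := Hone (vbase f); have [bg _] := Hone (vbase g).
pose z : vert_cat C := VMap bx u.
pose l : hom f z := @VHom C f z bf v (hdom k) (bang _ _ _) E.
pose t : @hom (arrow_cat C) (vdomF C g) (vdomF C z) :=
  @ArrHom C (vdomF C g) (vdomF C z) (idc _) bg (bang _ _ _).
have [|n [[n1 n2] nU]] := H z l t.
  by apply: arr_hom_eq; [exact: comp_idl | exact: bang].
have nd : hdom n = idc _ := f_equal (fun x : arr_hom _ _ => atop x) n1.
exists (hcod n); split.
  split; first by have := hsquare n; rewrite nd comp_idr.
  exact: (f_equal (fun x : vhom _ _ => hcod x) n2).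
move=> w [w1 w2].
have Hw : u ∘ idc _ = w ∘ varr g by rewrite comp_idr.
have -> // : n = @VHom C g z bg w (idc _) (bang _ _ _) Hw.
apply: nU; split; first by apply: arr_hom_eq.
by apply: vhom_eq; [exact: bang | exact: w2 | exact: comp_idl].
Qed.

Lemma step_one_factor_exists (m f : vert_cat C) (U : lifting_problem m f) :
  has_pushouts C ->
  exists (K : factorisation f) (k : hom (lp_map U) (Lob K)), is_step_one_factor k.
Proof.
move=> po; pose h := lp_hom U; pose M := lp_map U.
have [d [i [j H]]] := po _ _ _ (hdom h) (varr M).
have [|r [r1 r2]] := pushout_desc H (u := varr f) (v := hcod h); first exact: hsquare.
pose K := Factorisation r1.
have Hk : vproj (Lob K) ∘ j = hbase h ∘ vproj M by rewrite /= -comp_assoc r2 hproj.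
pose k : hom M (Lob K) := @VHom C M (Lob K) (hbase h) j (hdom h) Hk (proj1 H).
exists K, k; split; first exact: pushout_opcartesian.
by apply: vhom_eq => /=; rewrite ?comp_idl.
Qed.

Section Universal.
Context (m f : vert_cat C) (U : lifting_problem m f) (HU : is_universal_lp U).

Lemma lp_lift (N : vert_cat C) (k : hom N m) (h : hom N f) : is_cartesian (vfib C) k ->
  exists c : hom N (lp_map U), lp_cart U ∘ c = k /\ lp_hom U ∘ c = h.
Proof.
by move=> Hk; have [t [[_ [_ [c [_ Hc]]]] _]] := HU (LiftingProblem Hk h); exists c.
Qed.

(** Universality determines only the index map, so it yields [hbase c = hbase d]; the cartesian map
    [lp_cart U] extends this to the whole of [c] and [d]. *)
Lemma lp_ext (N : vert_cat C) (c d : hom N (lp_map U)) :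
  is_cartesian (vfib C) (lp_cart U ∘ c) ->
  lp_cart U ∘ c = lp_cart U ∘ d -> lp_hom U ∘ c = lp_hom U ∘ d -> c = d.
Proof.
move=> Hc E1 E2; apply: (cartesian_ext (lp_cartP (l := U))) => //.
have [t [_ Ht]] := HU (LiftingProblem Hc (lp_hom U ∘ c)).
transitivity t; [symmetry|]; apply: Ht.
- by split=> //; split=> //; exists c.
- rewrite /lp_sigma /lp_tau /= in E1 E2 *.
  split; first exact: (f_equal (fun x : vhom _ _ => hbase x) (esym E1)).
  split; first exact: (f_equal (fun x : vhom _ _ => hbase x) (esym E2)).
  by exists d.
Qed.

Context (K : factorisation f) (k : hom (lp_map U) (Lob K)) (Hk : is_step_one_factor k).

Lemma step_one_hbase : hbase k = hbase (lp_hom U).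
Proof. by rewrite -(proj2 Hk) /= comp_idl. Qed.

Lemma step_one_hdom : hdom k = hdom (lp_hom U).
Proof. by rewrite -(proj2 Hk) /= comp_idl. Qed.

(** Together with [lp_ext], this is what the equations of step one are checked with. *)
Lemma step_one_ext z (u v : hom (Lob K) z) :
  hbase u = hbase v -> hdom u = hdom v -> u ∘ k = v ∘ k -> u = v.
Proof.
move=> Eb Ed Ek; apply: (opcartesian_ext (proj1 Hk)) => //.
by apply: arr_hom_eq.
Qed.

Lemma step_one_desc z (n : hom (lp_map U) z) (b : hom (vbase f) (vbase z))
  (d : hom (vdom f) (vdom z)) :
  (vproj z ∘ varr z) ∘ d = b ∘ (vproj f ∘ varr f) ->
  b ∘ hbase (lp_hom U) = hbase n -> d ∘ hdom (lp_hom U) = hdom n ->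
  exists l : hom (Lob K) z, hbase l = b /\ hdom l = d /\ l ∘ k = n.
Proof.
move=> Hp Eb Ed.
have Hp' : aarr (vdomF C z) ∘ d = b ∘ aarr (vdomF C (Lob K)).
  by rewrite /= Hp -(fright_left K) -!comp_assoc.
have [|l [[l1 l2] _]] :=
  proj1 Hk z n (@ArrHom C (vdomF C (Lob K)) (vdomF C z) d b Hp').
  by apply: arr_hom_eq; [rewrite /= step_one_hdom | rewrite /= step_one_hbase].
exists l; split; first exact: (f_equal (fun x : arr_hom _ _ => abot x) l1).
by split=> //; exact: (f_equal (fun x : arr_hom _ _ => atop x) l1).
Qed.

End Universal.
End StepOneFactor.

(** The base and domain components of the comultiplication are fixed to be identities and the laws
    are propositions, so only the action on maps and [hcod] of the comultiplication can differ. *)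
Lemma lawfs_eq (C : category) (K : forall f : vert_cat C, factorisation f) (S S' : lawfs K) :
  (forall (f g : vert_cat C) (h : hom f g), fmap (Lfun S) h = fmap (Lfun S') h) ->
  (forall f : vert_cat C, hcod (lw_comult S f) = hcod (lw_comult S' f)) -> S = S'.
Proof.
move: S S' => [[F a b c d] del B1 D1 H] [[F' a' b' c' d'] del' B2 D2 H'] /= E1 E2.
have E : F = F'.
  do 3! (apply: functional_extensionality_dep => ?).
  exact: (f_equal (fun x : vhom _ _ => hcod x) (E1 _ _ _)).
subst F'.
have ? := proof_irrelevance _ a a'; have ? := proof_irrelevance _ b b'.
have ? := proof_irrelevance _ c c'; have ? := proof_irrelevance _ d d'; subst.
have E : del = del'.
  apply: functional_extensionality_dep => f.
  apply: vhom_eq; [|exact: E2|].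
  + exact: etrans (B1 f) (esym (B2 f)).
  + exact: etrans (D1 f) (esym (D2 f)).
subst del'.
by rewrite (proof_irrelevance _ B1 B2) (proof_irrelevance _ D1 D2)
  (proof_irrelevance _ H H').
Qed.

(** * The comonad of step one *)

Section StepOneLawfs.
Context (C : category) (m : vert_cat C) (D : step_one m).
Implicit Types f g z : vert_cat C.

Notation M f := (lp_map (so_lp D f)).
Notation cart f := (lp_cart (so_lp D f)).
Notation hm f := (lp_hom (so_lp D f)).
Notation k := (so_k D).
Notation L f := (Lob (so_fact D f)).

(** Both the action of [L] and the comultiplication arise from a map [n : M f -> g] by
    lifting it to [s : M f -> M g] and extending along [so_k D f]. *)
Definition induced f g (n : hom (M f) g) (l : hom (L f) (L g)) : Prop :=
  exists s : hom (M f) (M g), cart g ∘ s = cart f /\ hm g ∘ s = n /\ l ∘ k f = k g ∘ s.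

Lemma induced_exists f g (n : hom (M f) g) (b : hom (vbase f) (vbase g))
  (d : hom (vdom f) (vdom g)) :
  (vproj g ∘ varr g) ∘ d = b ∘ (vproj f ∘ varr f) ->
  b ∘ hbase (hm f) = hbase n -> d ∘ hdom (hm f) = hdom n ->
  exists l : hom (L f) (L g), hbase l = b /\ hdom l = d /\ induced n l.
Proof.
move=> Hp Hb Hd.
have [s [s1 s2]] := lp_lift (so_lpP D (f := g)) n (lp_cartP (l := so_lp D f)).
have [|||l [l1 [l2 l3]]] := step_one_desc (so_kP D f) (z := L g) (n := k g ∘ s) (b := b) (d := d).
- by rewrite /= -Hp -(fright_left (so_fact D g)) !comp_assoc.
- by rewrite Hb -s2 /= step_one_hbase //; apply: so_kP.
- by rewrite Hd -s2 /= step_one_hdom //; apply: so_kP.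
- by exists l; split=> //; split=> //; exists s.
Qed.

(** Both uniqueness principles combine: [n] determines [s] by [lp_ext], and then [k g ∘ s]
    determines [l] by [step_one_ext]. *)
Lemma induced_ext f g (n : hom (M f) g) (l l' : hom (L f) (L g)) :
  induced n l -> induced n l' -> hbase l = hbase l' -> hdom l = hdom l' -> l = l'.
Proof.
move=> [s [s1 [s2 s3]]] [s' [s1' [s2' s3']]] Eb Ed.
apply: (step_one_ext (so_kP D f)) => //; rewrite s3 s3'; congr (_ ∘ _).
apply: (lp_ext (so_lpP D (f := g))); rewrite ?s1' ?s2' ?s1 //; exact: lp_cartP.
Qed.

Lemma induced_counit f g (n : hom (M f) g) (l : hom (L f) (L g)) :
  induced n l -> Lcounit (so_fact D g) ∘ l ∘ k f = n.
Proof.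
move=> [s [_ [<- E]]].
by rewrite -comp_assoc E comp_assoc (proj2 (so_kP D g)).
Qed.

Lemma induced_id f : induced (hm f) (idc (L f)).
Proof. by exists (idc _); rewrite !comp_idr comp_idl. Qed.

Lemma induced_comp f g z (n : hom (M f) g) (l : hom (L f) (L g)) (h : hom g z)
  (l' : hom (L g) (L z)) :
  induced n l -> induced (h ∘ hm g) l' -> induced (h ∘ n) (l' ∘ l).
Proof.
move=> [s [s1 [s2 s3]]] [s' [s1' [s2' s3']]].
exists (s' ∘ s); split; first by rewrite comp_assoc s1'.
split; first by rewrite comp_assoc s2' -comp_assoc s2.
by rewrite -comp_assoc s3 comp_assoc s3' -comp_assoc.
Qed.

(** Here the second map is a comultiplication: the lift [s] of [n] turns [k g] into [k g ∘ s], which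
    is [l ∘ k f]. *)
Lemma induced_comult f g (n : hom (M f) g) (l : hom (L f) (L g))
  (l' : hom (L g) (L (L g))) :
  induced n l -> induced (k g) l' -> induced (l ∘ k f) (l' ∘ l).
Proof.
move=> [s [s1 [s2 s3]]] [s' [s1' [s2' s3']]].
exists (s' ∘ s); split; first by rewrite comp_assoc s1'.
split; first by rewrite comp_assoc s2' s3.
by rewrite -comp_assoc s3 comp_assoc s3' -comp_assoc.
Qed.

Lemma Lmap_exists f g (h : hom f g) :
  exists l : hom (L f) (L g), hbase l = hbase h /\ hdom l = hdom h /\ induced (h ∘ hm f) l.
Proof.
by apply: induced_exists => //; rewrite -comp_assoc (hsquare h) !comp_assoc (hproj h).
Qed.

Lemma comult_exists f :
  exists l : hom (L f) (L (L f)),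
    hbase l = idc (vbase f) /\ hdom l = idc (vdom f) /\ induced (k f) l.
Proof.
have Hk := so_kP D f.
apply: induced_exists.
- by rewrite comp_idl comp_idr /= -comp_assoc fright_left.
- by rewrite comp_idl (step_one_hbase Hk).
- by rewrite comp_idl (step_one_hdom Hk).
Qed.

(** The choice is harmless, since [induced_ext] makes the chosen map unique. *)
Definition Lmap f g (h : hom f g) : hom (L f) (L g) :=
  proj1_sig (constructive_indefinite_description _ (Lmap_exists h)).

Definition Lcomult f : hom (L f) (L (L f)) :=
  proj1_sig (constructive_indefinite_description _ (comult_exists f)).

Lemma LmapP f g (h : hom f g) :
  hbase (Lmap h) = hbase h /\ hdom (Lmap h) = hdom h /\ induced (h ∘ hm f) (Lmap h).
Proof. by rewrite /Lmap; case: (constructive_indefinite_description _ _). Qed.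

Lemma LcomultP f :
  hbase (Lcomult f) = idc (vbase f) /\ hdom (Lcomult f) = idc (vdom f) /\
  induced (k f) (Lcomult f).
Proof. by rewrite /Lcomult; case: (constructive_indefinite_description _ _). Qed.

Lemma Lmap_counit f g (h : hom f g) :
  Lcounit (so_fact D g) ∘ Lmap h = h ∘ Lcounit (so_fact D f).
Proof.
have [Eb [Ed Hi]] := LmapP h; have Hk := so_kP D f.
apply: (step_one_ext Hk).
- by rewrite /= Eb comp_idl comp_idr.
- by rewrite /= Ed comp_idl comp_idr.
- by rewrite (induced_counit Hi) -comp_assoc (proj2 Hk).
Qed.

Lemma Lmap_id f : Lmap (idc f) = idc (L f).
Proof.
have [Eb [Ed Hi]] := LmapP (idc f).
by apply: (induced_ext Hi) => //; rewrite comp_idl; apply: induced_id.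
Qed.

Lemma Lmap_comp f g z (v : hom g z) (u : hom f g) : Lmap (v ∘ u) = Lmap v ∘ Lmap u.
Proof.
have [Eb [Ed Hi]] := LmapP (v ∘ u).
have [Ebv [Edv Hiv]] := LmapP v; have [Ebu [Edu Hiu]] := LmapP u.
apply: (induced_ext Hi).
- by rewrite -comp_assoc; apply: induced_comp.
- by rewrite Eb /= Ebv Ebu.
- by rewrite Ed /= Edv Edu.
Qed.

Definition step_one_functorial : functorial (so_fact D).
Proof.
apply: (@Functorial C (so_fact D) (fun f g h => hcod (Lmap h))).
- by move=> f g h; have := hsquare (Lmap h); rewrite (proj1 (proj2 (LmapP h))).
- by move=> f g h; exact: (f_equal (fun x : vhom _ _ => hcod x) (Lmap_counit h)).
- by move=> f; rewrite Lmap_id.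
- by move=> f g z v u; rewrite Lmap_comp.
Defined.

Lemma LfunE f g (h : hom f g) : fmap (Lfun step_one_functorial) h = Lmap h.
Proof. by have [Eb [Ed _]] := LmapP h; apply: vhom_eq. Qed.

(** Both sides are induced by the same map: [Lmap h ∘ k f] for naturality of the comultiplication,
    [hm f] for the right counit law, [Lcomult f ∘ k f] for coassociativity. The left counit law is
    [induced_counit]. *)
Lemma step_one_comonad :
  is_comonad (L := Lfun step_one_functorial) (fun f => Lcounit (so_fact D f)) Lcomult.
Proof.
split.
- by move=> f g h; rewrite LfunE; apply: Lmap_counit.
- move=> f g h; rewrite !LfunE.
  have [Eb [Ed Hi]] := LmapP h; have [Eb2 [Ed2 Hi2]] := LmapP (Lmap h).
  have [Ebf [Edf Hf]] := LcomultP f; have [Ebg [Edg Hg]] := LcomultP g.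
  apply: (induced_ext (induced_comult Hi Hg) (induced_comp Hf Hi2)).
  + by rewrite /= Eb Eb2 Ebf Ebg Eb comp_idl comp_idr.
  + by rewrite /= Ed Ed2 Edf Edg Ed comp_idl comp_idr.
- move=> f; have [Ebf [Edf Hf]] := LcomultP f.
  apply: (step_one_ext (so_kP D f)).
  + by rewrite /= Ebf comp_idl.
  + by rewrite /= Edf comp_idl.
  + by rewrite comp_idl; apply: induced_counit Hf.
- move=> f; rewrite LfunE; have [Ebf [Edf Hf]] := LcomultP f.
  have [Eb [Ed Hi]] := LmapP (Lcounit (so_fact D f)).
  apply: (induced_ext (induced_comp Hf Hi)).
  + by rewrite (proj2 (so_kP D f)); apply: induced_id.
  + by rewrite /= Eb Ebf comp_idl.
  + by rewrite /= Ed Edf comp_idl.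
- move=> f; rewrite LfunE; have [Ebf [Edf Hf]] := LcomultP f.
  have [Eb2 [Ed2 H2]] := LcomultP (L f).
  have [Eb [Ed Hi]] := LmapP (Lcomult f).
  apply: (induced_ext (induced_comult Hf H2) (induced_comp Hf Hi)).
  + by rewrite /= Eb Ebf Eb2.
  + by rewrite /= Ed Edf Ed2.
Qed.

Definition step_one_lawfs : lawfs (so_fact D) :=
  @Lawfs C (so_fact D) step_one_functorial Lcomult
    (fun f => proj1 (LcomultP f)) (fun f => proj1 (proj2 (LcomultP f))) step_one_comonad.

(** The two clauses of [is_step_one_lawfs] are instances of [induced], so [induced_ext] identifies
    any other structure with the constructed one. *)
Lemma step_one_lawfs_unique : unique (@is_step_one_lawfs C m D) step_one_lawfs.
Proof.
split.
  split=> [f g h | f].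
  - rewrite LfunE; exact: (proj2 (proj2 (LmapP h))).
  - exact: (proj2 (proj2 (LcomultP f))).
move=> S [H1 H2]; apply: lawfs_eq.
- move=> f g h; rewrite LfunE; have [Eb [Ed Hi]] := LmapP h.
  exact: (induced_ext Hi (H1 f g h)).
- move=> f; have [Eb [Ed Hi]] := LcomultP f.
  apply: (f_equal (fun x : vhom _ _ => hcod x)); apply: (induced_ext Hi (H2 f)).
  + by rewrite Eb lw_comult_base.
  + by rewrite Ed lw_comult_dom.
Qed.

End StepOneLawfs.

(** * Algebra structures as solutions of the universal lifting problem *)

Section StepOneAlgebras.
Context (C : category) (m f : vert_cat C) (U : lifting_problem m f)
  (K : factorisation f) (k : hom (lp_map U) (Lob K)) (Hk : is_step_one_factor k).

(** The unit law makes the base and codomain components of [a] identities, so [hdom a] is a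
    retraction of [fleft K] over [vcod f]. *)
Lemma algebra_solution (a : hom (Rob K) f) : is_R_algebra a ->
  is_solution (P := U) (hdom a ∘ hcod k).
Proof.
move=> Ha.
have Ab : hbase a = idc _.
  by have := f_equal (fun x : vhom _ _ => hbase x) Ha; rewrite /= comp_idr.
have Ac : hcod a = idc _.
  by have := f_equal (fun x : vhom _ _ => hcod x) Ha; rewrite /= comp_idr.
have Ad : hdom a ∘ fleft K = idc _ := f_equal (fun x : vhom _ _ => hdom x) Ha.
have As : varr f ∘ hdom a = fright K by have := hsquare a; rewrite Ac comp_idl.
have Kc : fright K ∘ hcod k = hcod (lp_hom U) :=
  f_equal (fun x : vhom _ _ => hcod x) (proj2 Hk).
have Ks : fleft K ∘ hdom k = hcod k ∘ varr (lp_map U) := hsquare k.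
split; first by rw As; rewrite Kc (hproj (lp_hom U)).
split; last by rw As.
by rewrite -comp_assoc -Ks (step_one_hdom Hk); rw Ad.
Qed.

Lemma solution_algebra (j : hom (vcod (lp_map U)) (vdom f)) : is_solution (P := U) j ->
  exists! a : hom (Rob K) f, is_R_algebra a /\ hdom a ∘ hcod k = j.
Proof.
move=> [j1 [j2 j3]].
(* A map from [Lob K] to this identity map with identity base and domain components is a retraction
   of [fleft K]. The solution [j] gives such a map after restriction along [k]. *)
pose z : vert_cat C := VMap (vproj f ∘ varr f) (idc (vdom f)).
have nP : idc (vdom f) ∘ hdom (lp_hom U) = j ∘ varr (lp_map U) by rewrite comp_idl j2.
pose n : hom (lp_map U) z := @VHom C (lp_map U) z (lp_tau U) j (hdom (lp_hom U)) j1 nP.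
have [|||l [l1 [l2 l3]]] := step_one_desc Hk (z := z) (n := n) (b := idc _) (d := idc _).
- by rewrite /= !comp_idl !comp_idr.
- by rewrite comp_idl.
- by rewrite comp_idl.
have lc : hcod l ∘ hcod k = j := f_equal (fun x : vhom _ _ => hcod x) l3.
have ls : hcod l ∘ fleft K = idc (vdom f).
  by have := hsquare l; rewrite /= l2 comp_idl.
have lr : varr f ∘ hcod l = fright K.
  have zP : varr f ∘ idc (vdom f) = varr f ∘ idc (vdom f) by [].
  have zP' : vproj f ∘ varr f = idc _ ∘ (vproj f ∘ varr f) by rewrite comp_idl.
  pose e : hom z f := @VHom C z f (idc _) (varr f) (idc _) zP' zP.
  have E : e ∘ l = Lcounit K.
    apply: (step_one_ext Hk).
    + by rewrite /= l1 comp_idl.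
    + by rewrite /= l2 comp_idl.
    + by rewrite -comp_assoc l3 (proj2 Hk); apply: vhom_eq => //=; rewrite comp_idl.
  exact: (f_equal (fun x : vhom _ _ => hcod x) E).
have aP : vproj f ∘ idc (vcod f) = idc (vbase f) ∘ vproj f by rewrite comp_idl comp_idr.
have aS : varr f ∘ hcod l = idc (vcod f) ∘ fright K by rewrite comp_idl.
exists (@VHom C (Rob K) f (idc _) (idc _) (hcod l) aP aS); split.
  by split=> //; apply: vhom_eq => /=; rewrite ?comp_idl.
move=> a [Ha Hj].
have Ab : idc _ = hbase a.
  by have := f_equal (fun x : vhom _ _ => hbase x) Ha; rewrite /= comp_idr.
have Ac : idc _ = hcod a.
  by have := f_equal (fun x : vhom _ _ => hcod x) Ha; rewrite /= comp_idr.
have Ad : hdom a ∘ fleft K = idc _ := f_equal (fun x : vhom _ _ => hdom x) Ha.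
apply: vhom_eq => //=.
have As : varr f ∘ hdom a = fright K by have := hsquare a; rewrite -Ac comp_idl.
have E1 : vproj z ∘ hdom a = idc (vbase f) ∘ vproj (Lob K).
  by rewrite /= -comp_assoc As comp_idl.
have E2 : varr z ∘ idc (vdom f) = hdom a ∘ varr (Lob K) by rewrite /= comp_idl Ad.
(* A competing algebra structure is also a map into [z], so [step_one_ext] compares it with [l]. *)
have E : l = @VHom C (Lob K) z (idc _) (hdom a) (idc _) E1 E2.
  apply: (step_one_ext Hk) => //; rewrite l3; apply: vhom_eq => //=.
  - by rewrite comp_idl (step_one_hbase Hk).
  - by rewrite comp_idl (step_one_hdom Hk).
by rewrite E.
Qed.

End StepOneAlgebras.

(** * Reindexing of step one *)

Section Reindexing.
Context (C : category) (C_lccc : is_lccc C) (C_lim : has_finite_limits C).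

(** Maps [d' -> x] correspond to sections over [d] of a dependent product along [e], so
    that a descent problem for [d'] becomes one for [d]. *)
Lemma pushout_stable (a b c d a' b' c' d' : C) (f : hom a b) (g : hom a c)
  (i : hom b d) (j : hom c d) (f' : hom a' b') (g' : hom a' c') (i' : hom b' d')
  (j' : hom c' d') (ea : hom a' a) (eb : hom b' b) (ec : hom c' c) (e : hom d' d) :
  is_pushout f g i j -> i' ∘ f' = j' ∘ g' ->
  eb ∘ f' = f ∘ ea -> ec ∘ g' = g ∘ ea ->
  is_pb eb i' i e -> is_pb ec j' j e -> is_pb ea (i' ∘ f') (i ∘ f) e ->
  is_pushout f' g' i' j'.
Proof.
move=> po sq Ef Eg pbb pbc pba.
have sq0 := proj1 po.
have [one Hone] := terminal_exists C_lim.
have bang (y : C) (u v : hom y one) : u = v.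
  by have [w [_ Hw]] := Hone y; rewrite -(Hw u) // -(Hw v).
have to_one (y : C) : exists u : hom y one, True by have [u _] := Hone y; exists u.
split=> // x u v Euv.
have [bx _] := to_one x.
have [E [P [s [t [p1 [p2 [ev [HP [_ U]]]]]]]]] := universal_map C_lccc C_lim e bx.
(* The terminal [one] makes [E] represent plain maps to [x] out of pullbacks of [e]. Here [h] is the
   transpose of [n : Q -> x], for [Q] the pullback of [e] along [s']. *)
pose tr (K Q : C) (s' : hom K d) (q1 : hom Q K) (q2 : hom Q d') (n : hom Q x)
  (h : hom K E) := s ∘ h = s' /\
    exists v : hom Q P, p1 ∘ v = h ∘ q1 /\ p2 ∘ v = q2 /\ ev ∘ v = n.
have trex (K Q : C) s' q1 q2 n : @is_pb C Q K d' d q1 q2 s' e ->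
    exists h : hom K E, tr K Q s' q1 q2 n h.
  move=> Hq; have [tk _] := to_one K.
  by have [h [[h1 [_ h2]] _]] := U K Q s' tk q1 q2 n Hq (bang _ _ _); exists h.
have trun (K Q : C) s' q1 q2 n (h h' : hom K E) : @is_pb C Q K d' d q1 q2 s' e ->
    tr K Q s' q1 q2 n h -> tr K Q s' q1 q2 n h' -> h = h'.
  move=> Hq [h1 h2] [h1' h2']; have [tk _] := to_one K.
  have [r [_ Hr]] := U K Q s' tk q1 q2 n Hq (bang _ _ _).
  by rewrite -(Hr h) // -(Hr h').
have trcomp (K Q : C) s' q1 q2 n h (K' Q' : C) (r : hom K' K) (r' : hom Q' Q)
    (q1' : hom Q' K') : tr K Q s' q1 q2 n h -> q1 ∘ r' = r ∘ q1' ->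
    tr K' Q' (s' ∘ r) q1' (q2 ∘ r') (n ∘ r') (h ∘ r).
  move=> [<- [w [w1 [<- <-]]]] Er; split; first by cassoc.
  by exists (w ∘ r'); cassoc; split=> //; rw w1; rewrite Er.
have [hb Hb] := trex _ _ i eb i' u pbb.
have [hc Hc] := trex _ _ j ec j' v pbc.
(* By naturality of transposition, both sides are transposes of [u ∘ f'], which equals [v ∘ g']. *)
have Ebc : hb ∘ f = hc ∘ g.
  apply: (trun _ _ _ _ _ _ _ _ pba (trcomp _ _ _ _ _ _ _ _ _ _ _ _ Hb Ef)).
  by rewrite sq0 sq Euv; apply: trcomp Hc Eg.
have [w [w1 w2]] := pushout_desc po Ebc.
have sw : s ∘ w = idc d.
  apply: (pushout_ext po); rewrite -comp_assoc ?w1 ?w2 comp_idl;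
    [exact: (proj1 Hb) | exact: (proj1 Hc)].
(* As [d'] is the pullback of [e] along the identity of [d], the section [w] transposes back to
   [ev ∘ y]. *)
have [|y [y1 y2]] := pb_lift HP (u := w ∘ e) (v := idc d').
  by rewrite comp_assoc sw comp_idl comp_idr.
have yP (K Q : C) s' q1 q2 n (h : hom K E) : e ∘ q2 = s' ∘ q1 ->
    tr K Q s' q1 q2 n h -> h = w ∘ s' -> ev ∘ y ∘ q2 = n.
  move=> Eq [h1 [z [z1 [z2 <-]]]] Eh; rewrite -comp_assoc; congr (_ ∘ _).
  apply: (pb_ext HP); first by rw y1; rewrite z1 Eh Eq; cassoc.
  by rewrite z2; rw y2.
exists (ev ∘ y); split.
  split.
  - by apply: yP Hb (esym w1); rewrite (proj1 pbb).
  - by apply: yP Hc (esym w2); rewrite (proj1 pbc).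
move=> n [n1 n2].
have pbd : is_pb e (idc d') (idc d) e := pb_sym (pb_id e).
have [h Hh] := trex _ _ (idc d) e (idc d') n pbd.
have Ehw : h = w ∘ idc d.
  rewrite comp_idr; apply: (pushout_ext po).
  - rewrite w1; apply: (trun _ _ _ _ _ _ _ _ pbb _ Hb).
    have := trcomp _ _ _ _ _ _ _ _ _ i i' eb Hh (esym (proj1 pbb)).
    by rewrite !comp_idl n1.
  - rewrite w2; apply: (trun _ _ _ _ _ _ _ _ pbc _ Hc).
    have := trcomp _ _ _ _ _ _ _ _ _ j j' ec Hh (esym (proj1 pbc)).
    by rewrite !comp_idl n2.
rewrite -[ev ∘ y]comp_idr; apply: yP Hh Ehw.
by rewrite comp_idl comp_idr.
Qed.

(** A problem against [f] whose index map to the base factors through [hbase h] is the same as a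
    problem against [f'], because [h] is cartesian. *)
Lemma universal_lp_index_pb (m f f' : vert_cat C) (U : lifting_problem m f)
  (U' : lifting_problem m f') (h : hom f' f) (s : hom (lp_map U') (lp_map U)) :
  is_universal_lp U -> is_universal_lp U' -> is_cartesian (vfib C) h ->
  lp_cart U ∘ s = lp_cart U' -> lp_hom U ∘ s = h ∘ lp_hom U' ->
  is_pb (hbase s) (lp_tau U') (lp_tau U) (hbase h).
Proof.
move=> HU HU' Hh Es1 Es2; rewrite /lp_tau.
have Cu := lp_cartP (l := U); have Cu' := lp_cartP (l := U').
have sq : hbase (lp_hom U) ∘ hbase s = hbase h ∘ hbase (lp_hom U') :=
  f_equal (fun x : vhom _ _ => hbase x) Es2.
have scart : hbase (lp_cart U) ∘ hbase s = hbase (lp_cart U') :=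
  f_equal (fun x : vhom _ _ => hbase x) Es1.
apply: pb_intro => //.
- move=> T a b Eab.
  have [c [d [p [v [r [rb /vpb_cartesian Hr]]]]]] := vpb_exists C_lccc (g := lp_map U) a.
  have [|n [nb nh]] := cartesian_lift Hh (k := lp_hom U ∘ r) (t := b).
    by rewrite /= rb.
  have Cr := cartesian_comp Cu Hr.
  have [w [w1 w2]] := lp_lift HU' n Cr.
  have sw : s ∘ w = r.
    apply: (lp_ext HU).
    + by rewrite comp_assoc Es1 w1.
    + by rewrite comp_assoc Es1 w1.
    + by rewrite comp_assoc Es2 -comp_assoc w2 nh.
  exists (hbase w); split.
    by rewrite -rb -sw.
  by rewrite -nb -w2.
- move=> T a b Es Eh.
  (* Index maps are compared by realising [a] and [b] as base components of two maps [r] and [r']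
     out of the same reindexing of [m]. Both classify the same problem against [f']. *)
  have [c [d [p [v [r [rb /vpb_cartesian Hr]]]]]] := vpb_exists C_lccc (g := lp_map U') a.
  have [|r' [rb' Er']] := cartesian_lift Cu' (k := lp_cart U' ∘ r) (t := b).
    by rewrite /= rb -scart -!comp_assoc Es.
  have Err : s ∘ r = s ∘ r'.
    apply: (cartesian_ext Cu); first by rewrite /= rb rb'.
    by rewrite !comp_assoc Es1.
  suff E : r = r' by rewrite -rb -rb' E.
  apply: (lp_ext HU') => //; first exact: cartesian_comp.
  apply: (cartesian_ext Hh); first by rewrite /= rb rb'.
  by rewrite !comp_assoc -Es2 -!comp_assoc Err.
Qed.

Lemma step_one_fibred (m : vert_cat C) (D : step_one m) (S : lawfs (so_fact D)) :
  is_step_one_lawfs S -> is_fibred S.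
Proof.
move=> [HS _]; apply: is_fibred_of_R => // f' f h Hh.
have [s [Es1 [Es2 Ek]]] := HS f' f h.
have HM : is_vpb s.
  apply: cartesian_vpb => //; apply: (cartesian_cancel (lp_cartP (l := so_lp D f))).
  by rewrite Es1; apply: lp_cartP.
have HI := universal_lp_index_pb (so_lpP D (f := f)) (so_lpP D (f := f')) Hh Es1 Es2.
have [hc hd] := cartesian_vpb C_lccc Hh.
apply: vpb_cartesian; split=> //=.
have [one Hone] := terminal_exists C_lim.
have kP := so_kP D f; have kP' := so_kP D f'.
have [HMc HMd] := HM.
move: HI kP kP' Ek Es2 HMc HMd; rewrite /lp_tau.
set hm := lp_hom (so_lp D f); set hm' := lp_hom (so_lp D f').
set k := so_k D f; set k' := so_k D f'; set K := so_fact D f; set K' := so_fact D f'.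
set M := lp_map (so_lp D f); set M' := lp_map (so_lp D f').
move=> HI kP kP' Ek Es2 HMc HMd.
pose kc : hom (vcod M) (fmid K) := hcod k.
pose kc' : hom (vcod M') (fmid K') := hcod k'.
have po : is_pushout (hdom hm) (varr M) (fleft K) kc.
  by have := opcartesian_pushout Hone (proj1 kP); rewrite (step_one_hdom kP).
have po' : is_pushout (hdom hm') (varr M') (fleft K') kc'.
  by have := opcartesian_pushout Hone (proj1 kP'); rewrite (step_one_hdom kP').
(* It remains to identify [fmid K'] with [Z], the reindexing of [fmid K]. By [pushout_stable], [Z]
   is a pushout of the span whose pushout is [fmid K']. *)
have [Z [z1 [z2 HZ]]] := pb_exists C_lccc (vproj f ∘ fright K) (hbase h).
have kp : vproj f ∘ fright K ∘ kc = hbase hm ∘ vproj M.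
  by have := hproj k; rewrite (step_one_hbase kP).
have Eh : hdom hm ∘ hdom s = hdom h ∘ hdom hm' := f_equal (fun x : vhom _ _ => hdom x) Es2.
have EI : hbase hm ∘ hbase s = hbase h ∘ hbase hm' := proj1 HI.
have [|i' [i1 i2]] := pb_lift HZ (u := fleft K ∘ hdom h) (v := vproj f' ∘ varr f').
  by rw (fright_left K); rw (hsquare h); rw (hproj h).
have [|j' [j1 j2]] := pb_lift HZ (u := kc ∘ hcod s)
  (v := hbase hm' ∘ vproj M').
  by rewrite comp_assoc kp; cassoc; rw (hproj s); rw EI.
have Ekd : fleft K ∘ hdom hm = kc ∘ varr M := proj1 po.
have sq : i' ∘ hdom hm' = j' ∘ varr M'.
  apply: (pb_ext HZ).
  - by rw i1; rewrite -Eh; rw Ekd; rw j1; rewrite (hsquare s).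
  - by rw i2; rw j2; rw (hsquare hm'); rw (hproj hm').
have HZ' := pb_sym HZ.
have pob : is_pb (hdom h) i' (fleft K) z1.
  apply: pb_sym; apply: (pb_cancel HZ') => //.
  rewrite i2 -comp_assoc fright_left; exact: pb_sym.
(* The squares of [s] are pullbacks along [hbase s]; pasting with [HI] makes them pullbacks along
   [hbase h], and cancelling [HZ'] leaves squares over [z1]. *)
have poc : is_pb (hcod s) j' (kc) z1.
  apply: pb_sym; apply: (pb_cancel HZ') => //.
  rewrite j2 kp; exact: pb_paste (pb_sym HI) (pb_sym HMc).
have poa : is_pb (hdom s) (i' ∘ hdom hm') (fleft K ∘ hdom hm) z1.
  apply: pb_sym; apply: (pb_cancel HZ').
  - by rw i1; rewrite -Eh; cassoc.
  - have -> : vproj f ∘ fright K ∘ (fleft K ∘ hdom hm) = hbase hm ∘ (vproj M ∘ varr M).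
      by rewrite Ekd comp_assoc kp; cassoc.
    have -> : z2 ∘ (i' ∘ hdom hm') = hbase hm' ∘ (vproj M' ∘ varr M').
      by rewrite sq; rw j2.
    exact: pb_paste (pb_sym HI) (pb_sym HMd).
have poZ := pushout_stable po sq (esym Eh) (esym (hsquare s)) pob poc poa.
have kr : fright K ∘ kmap S h = hcod h ∘ fright K' := kmap_right S h.
have kl : kmap S h ∘ fleft K' = fleft K ∘ hdom h := kmap_left S h.
have kk : kmap S h ∘ kc' = kc ∘ hcod s := f_equal (fun x : vhom _ _ => hcod x) Ek.
have [|p [pz1 pz2]] := pb_lift HZ (u := kmap S h) (v := vproj f' ∘ fright K').
  by rw kr; rw (hproj h).
have pl : p ∘ fleft K' = i'.
  apply: (pb_ext HZ); first by rw pz1; rewrite kl i1.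
  by rw pz2; rewrite fright_left i2.
have pk : p ∘ kc' = j'.
  apply: (pb_ext HZ); first by rw pz1; rewrite kk j1.
  rw pz2; rewrite j2 -(step_one_hbase kP').
  by rewrite comp_assoc; exact: (hproj k').
(* The pushout comparison [q] is inverse to the pullback comparison [p]. *)
have [q [q1 q2]] := pushout_desc poZ (proj1 po').
apply: (pb_iso (i := p) (j := q) HZ) => //.
- by apply: (pushout_ext poZ); rewrite -comp_assoc ?q1 ?q2 comp_idl.
- by apply: (pushout_ext po'); rewrite -comp_assoc ?pl ?pk ?q1 ?q2 comp_idl.
Qed.
End Reindexing.

(** * Algebraically free awfs's *)

Section FreeAlgebras.
Context (A : category) (T T' : functor A A) (eta : forall x, hom x (T x))
  (eta' : forall x, hom x (T' x)) (mu : forall x, hom (T' (T' x)) (T' x))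
  (phi : forall x, hom (T x) (T' x))
  (phi_nat : forall x y (h : hom x y), phi y ∘ fmap T h = fmap T' h ∘ phi x)
  (phi_unit : forall x, phi x ∘ eta x = eta' x).

(** Bijectivity on objects equips [pa_ob b] with a monad algebra structure [s] restricting to that
    of [b]. Then [T' x], free for the monad, is free for the pointed endofunctor as well. *)
Lemma free_algebra : is_monad eta' mu ->
  is_cat_iso (fcomp (palg_restr phi_nat phi_unit) (malg_to_palg eta' mu)) ->
  forall (x : A) (b : palg eta) (u : hom x (pa_ob b)),
  exists! v : hom (T' x) (pa_ob b),
    v ∘ eta' x = u /\ v ∘ (mu x ∘ phi (T' x)) = pa_str b ∘ fmap T v.
Proof.
move=> [e_nat m_nat unitl unitr assoc] [iso_ob iso_hom] x b.
have [c [<- _]] := iso_ob b; move: c => [[g s Hs] /= Hm] u.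
exists (s ∘ fmap T' u); split.
  split; first by rewrite -comp_assoc -e_nat comp_assoc Hs comp_idl.
  cassoc; rw (esym (m_nat _ _ u)); rewrite comp_assoc Hm !fmap_comp; cassoc.
  by rw (phi_nat s); rw (phi_nat (fmap T' u)).
move=> v [Hu Hv].
pose F : malg_cat eta' mu := exist _ (PAlg (unitl x)) (assoc x).
pose G : malg_cat eta' mu := exist _ (PAlg Hs) Hm.
(* Fullness upgrades [v] from a map of [T]-algebras to one of [T']-algebras. *)
have [w [Ew _]] := iso_hom F G (exist _ v Hv).
have E : proj1_sig w = v := f_equal (@proj1_sig _ _) Ew.
have Hw : v ∘ mu x = s ∘ fmap T' v by rewrite -E; exact: (proj2_sig w).
by rewrite -Hu fmap_comp comp_assoc -Hw -comp_assoc unitr comp_idr.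
Qed.

End FreeAlgebras.

(** * The right adjoint to reindexing of vertical maps *)

Section VerticalProduct.
Context (C : category) (C_lccc : is_lccc C).

(** The right adjoint to reindexing along [t], in pullback-stable form; [d] exhibits the
    reindexing of the product and [ep] is the counit. *)
Lemma vertical_product (J : C) (g : vert_cat C) (t : hom (vbase g) J) :
  exists (c0 d0 : C) (p0 : hom c0 J) (a0 : hom d0 c0)
    (c1 d1 : C) (p1 : hom c1 (vbase g)) (a1 : hom d1 c1)
    (d : @hom (vert_cat C) (VMap p1 a1) (VMap p0 a0))
    (ep : @hom (vert_cat C) (VMap p1 a1) g),
    is_cartesian (vfib C) d /\ hbase d = t /\ hbase ep = idc _ /\
    forall (z y : vert_cat C) (x : hom y z) (w : hom y g) (u : hom (vbase z) J),
      is_cartesian (vfib C) x -> is_pb (hbase x) (hbase w) u t ->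
      exists! l : @hom (vert_cat C) z (VMap p0 a0), hbase l = u /\
        exists l' : hom y (VMap p1 a1), d ∘ l' = l ∘ x /\ ep ∘ l' = w.
Proof.
have [Ec [Pc [sc [p1c [p2c [evc [HPc [Hevc Uc]]]]]]]] := dependent_product C_lccc t (vproj g).
have [Ed [Pd [sd [p1d [p2d [evd [HPd [Hevd Ud]]]]]]]] :=
  dependent_product C_lccc t (vproj g ∘ varr g).
(* Codomain and domain have separate dependent products along [t]; [a] is the map between them given
   by postcomposition with [varr g]. *)
have [|a [[a1 [va [va1 [va2 va3]]]] _]] := Uc _ _ sd p1d p2d (varr g ∘ evd) HPd.
  by rewrite comp_assoc.
have ep1 : vproj g ∘ evc = idc _ ∘ p2c by rewrite comp_idl.
pose d : @hom (vert_cat C) (VMap p2c va) (VMap sc a) :=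
  @VHom C (VMap p2c va) (VMap sc a) t p1c p1d (proj1 HPc) (esym va1).
exists Ec, Ed, sc, a, Pc, Pd, p2c, va, d,
  (@VHom C (VMap p2c va) g (idc _) evc evd ep1 (esym va3)).
split; first by apply: vpb_cartesian; split=> //=; rewrite va2 a1.
split=> //; split=> // z y x w u /(cartesian_vpb C_lccc) [xc xd] Hpb.
have Hc := pb_sym (pb_paste (pb_sym Hpb) (pb_sym xc)).
have Hd := pb_sym (pb_paste (pb_sym Hpb) (pb_sym xd)).
have [lc [[lc1 [vc [vc1 [vc2 vc3]]]] Ulc]] := Uc _ _ _ _ _ (hcod w) Hc (hproj w).
have Hw : vproj g ∘ varr g ∘ hdom w = hbase w ∘ (vproj y ∘ varr y).
  by cassoc; rewrite (hsquare w); rw (hproj w).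
have [ld [[ld1 [vd [vd1 [vd2 vd3]]]] Uld]] := Ud _ _ _ _ _ (hdom w) Hd Hw.
(* Both sides are transposes of [hcod w ∘ varr y]. *)
have sq : a ∘ ld = lc ∘ varr z.
  have [|r [_ Hr]] := Uc _ _ _ _ _ (hcod w ∘ varr y) Hd.
    by rw (hproj w).
  transitivity r; [symmetry|]; apply: Hr.
  - split; first by rw a1; rewrite ld1.
    exists (va ∘ vd); split; first by rw va1; rewrite vd1.
    split; first by rw va2; rewrite vd2.
    by rw va3; rewrite vd3 (hsquare w).
  - split; first by rw lc1.
    exists (vc ∘ varr y); split; first by rw vc1; rewrite (hsquare x).
    split; first by rw vc2.
    by rw vc3.
have sq' : va ∘ vd = vc ∘ varr y.
  apply: (pb_ext HPc).
  - by rw va1; rewrite vd1; rw sq; rw vc1; rewrite (hsquare x).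
  - by rw va2; rewrite vd2; rw vc2.
exists (@VHom C z (VMap sc a) u lc ld lc1 sq); split.
  split=> //; exists (@VHom C y (VMap p2c va) (hbase w) vc vd vc2 sq').
  split; apply: vhom_eq => //=; last by rewrite comp_idl.
  exact: (esym (proj1 Hpb)).
move=> l [lb [l' [l1 l2]]].
have Eb : hbase l' = hbase w.
  by rewrite -[RHS](f_equal (fun n : vhom _ _ => hbase n) l2) /= comp_idl.
have Ec1 : p1c ∘ hcod l' = hcod l ∘ hcod x := f_equal (fun n : vhom _ _ => hcod n) l1.
have Ed1 : p1d ∘ hdom l' = hdom l ∘ hdom x := f_equal (fun n : vhom _ _ => hdom n) l1.
have Ec2 : evc ∘ hcod l' = hcod w := f_equal (fun n : vhom _ _ => hcod n) l2.
have Ed2 : evd ∘ hdom l' = hdom w := f_equal (fun n : vhom _ _ => hdom n) l2.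
have Hl : sc ∘ hcod l = u ∘ vproj z by rewrite -lb; exact: (hproj l).
have Hl' : p2c ∘ hcod l' = hbase w ∘ vproj y by rewrite -Eb; exact: (hproj l').
have Sl : a ∘ hdom l = hcod l ∘ varr z := hsquare l.
have Sl' : va ∘ hdom l' = hcod l' ∘ varr y := hsquare l'.
apply: vhom_eq => //=.
- by apply: Ulc; split=> //; exists (hcod l').
- apply: Uld; split; first by rewrite -a1 -comp_assoc Sl; rw Hl.
  exists (hdom l'); split=> //; split=> //.
  by rewrite -va2 -comp_assoc Sl'; rw Hl'.
Qed.

End VerticalProduct.

(** * Reindexing of free algebras *)

Section AlgebraicallyFree.
Context (C : category) (C_lccc : is_lccc C).
Context (K K' : forall f : vert_cat C, factorisation f) (S : lawfs K) (A : awfs K')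
  (theta : lawfs_hom S A) (HS : is_fibred S) (HA : algebraically_free theta).
Implicit Types f g : vert_cat C.

Notation R := (Rfun S).
Notation R' := (Rfun A).
Notation eta g := (Runit (K g)).
Notation eta' g := (Runit (K' g)).

(** The free monad algebra on [f], restricted along [theta]. *)
Definition free_str f : hom (R (R' f)) (R' f) := aw_mult A f ∘ fh_R theta (R' f).

Lemma Runit_nat (K0 : forall f : vert_cat C, factorisation f) (F : functorial K0) f g
  (h : hom f g) : Runit (K0 g) ∘ h = fmap (Rfun F) h ∘ Runit (K0 f).
Proof.
by apply: vhom_eq => /=; rewrite ?comp_idl ?comp_idr ?kmap_left.
Qed.

Lemma free_str_unit f : free_str f ∘ eta (R' f) = idc _.
Proof.
rewrite /free_str -comp_assoc (fh_R_unit theta); exact: (m_unitl (aw_monad A)).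
Qed.

Lemma free_str_nat f g (h : hom f g) :
  fmap R' h ∘ free_str f = free_str g ∘ fmap R (fmap R' h).
Proof.
rewrite /free_str -comp_assoc (fh_R_nat theta) !comp_assoc.
by rewrite (m_mu_nat (aw_monad A)).
Qed.

Lemma algebra_hbase g (b : hom (R g) g) : b ∘ eta g = idc g -> hbase b = idc _.
Proof. by move=> H; have := f_equal (fun x : vhom _ _ => hbase x) H; rewrite /= comp_idr. Qed.

Lemma free_extension f g (b : hom (R g) g) (u : hom f g) : b ∘ eta g = idc g ->
  exists! v : hom (R' f) g, v ∘ eta' f = u /\ v ∘ free_str f = b ∘ fmap R v.
Proof.
by move=> Hb; apply: (free_algebra (aw_monad A) HA (b := PAlg Hb)).
Qed.

Lemma free_extension_ext f g (b : hom (R g) g) (v w : hom (R' f) g) :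
  b ∘ eta g = idc g -> v ∘ free_str f = b ∘ fmap R v ->
  w ∘ free_str f = b ∘ fmap R w -> v ∘ eta' f = w ∘ eta' f -> v = w.
Proof.
move=> Hb Hv Hw E; have [r [_ Hr]] := free_extension (w ∘ eta' f) Hb.
by rewrite -(Hr v) // -(Hr w).
Qed.

Section Reindexing.
Context (f f' : vert_cat C) (h : hom f' f) (Hh : is_cartesian (vfib C) h).
Context (cq dq : C) (pq : hom cq (vbase f')) (aq : hom dq cq).
Notation q := (VMap pq aq : vert_cat C).
Context (c : hom q (R' f)) (Hc : is_cartesian (vfib C) c) (cb : hbase c = hbase h).
Context (e : hom f' q) (eb : hbase e = idc _) (ce : c ∘ e = eta' f ∘ h).
Context (bq : hom (R q) q) (bq_unit : bq ∘ eta q = idc q)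
  (cbq : c ∘ bq = free_str f ∘ fmap R c).

(** The reindexing [q] of the free algebra on [f] is free on the reindexing [f']: an
    algebra [g] over the base of [f'] induces one on its product along [hbase h], and
    transposition turns extensions along [e] into extensions along [eta' f]. *)
Lemma reindexed_free (cg dg : C) (pg : hom cg (vbase f')) (ag : hom dg cg)
  (g := VMap pg ag : vert_cat C) (b : hom (R g) g) (u : hom f' g) :
  b ∘ eta g = idc g -> hbase u = idc _ ->
  exists! v : hom q g, hbase v = idc _ /\ v ∘ e = u /\ v ∘ bq = b ∘ fmap R v.
Proof.
move=> Hb ub.
have [c0 [d0 [p0 [a0 [c1 [d1 [p1 [a1 [d [ep [Hd [db [epb U]]]]]]]]]]]]] :=
  vertical_product C_lccc (J := vbase f) (g := g) (hbase h).
move: d ep Hd db epb U.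
set G : vert_cat C := VMap p0 a0; set D : vert_cat C := VMap p1 a1.
move=> d ep Hd db epb U.
have bb := algebra_hbase Hb; have bqb := algebra_hbase bq_unit.
have pbt : is_pb (hbase h) (idc _) (idc _) (hbase h) := pb_sym (pb_id _).
(* The algebra structure on the product [G] is the transpose of [b ∘ fmap R ep]. This uses that
   [fmap R d] is cartesian, as [R] is fibred. *)
have [gm [[gmb [gm' [gm1 gm2]]] _]] :
    exists! gm : hom (R G) G, hbase gm = idc _ /\
      exists gm' : hom (R D) D, d ∘ gm' = gm ∘ fmap R d /\ ep ∘ gm' = b ∘ fmap R ep.
  apply: (U (R G) (R D) (fmap R d) (b ∘ fmap R ep) (idc _)); first exact: (proj2 (HS Hd)).
  by rewrite /= db bb epb comp_idl.
have gmb' : hbase gm' = idc _.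
  have := f_equal (fun x : vhom _ _ => hbase x) gm2.
  by rewrite /= bb epb !comp_idl.
have gm_unit : gm ∘ eta G = idc G.
  have [|r [_ Hr]] := U G D d ep (idc _) Hd; first by rewrite db epb.
  transitivity r; [symmetry|]; apply: Hr.
  - split; first by rewrite /= gmb comp_idl.
    exists (gm' ∘ eta D); rewrite !comp_assoc gm1 gm2 -!comp_assoc -!Runit_nat.
    by rewrite !comp_assoc Hb comp_idl.
  - by split=> //; exists (idc _); rewrite !comp_idr comp_idl.
(* [k] is the transpose of [u]; it extends to [v0] on the free algebra on [f]. Reindexing [v0] to
   [v0'] and applying the counit [ep] gives the extension of [u]. *)
have [|k [[kb [k' [k1 k2]]] kU]] := U f f' h u (idc _) Hh; first by rewrite ub.
have kb' : hbase k' = idc _.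
  have := f_equal (fun x : vhom _ _ => hbase x) k2.
  by rewrite /= epb ub comp_idl.
have [v0 [[v01 v02] v0U]] := free_extension k gm_unit.
have v0b : hbase v0 = idc _.
  have := f_equal (fun x : vhom _ _ => hbase x) v01.
  by rewrite /= kb comp_idr.
have [|v0' [v0b' Hv0']] := cartesian_lift Hd (k := v0 ∘ c) (t := idc _).
  by rewrite /= v0b cb db comp_idl comp_idr.
have v0e : v0' ∘ e = k'.
  apply: (cartesian_ext Hd); first by rewrite /= v0b' eb kb' comp_idl.
  by rewrite comp_assoc Hv0' k1 -comp_assoc ce comp_assoc v01.
have v0bq : v0' ∘ bq = gm' ∘ fmap R v0'.
  apply: (cartesian_ext Hd); first by rewrite /= v0b' bqb gmb'.
  rewrite !comp_assoc Hv0' gm1 -!comp_assoc cbq comp_assoc v02.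
  by rewrite -!comp_assoc -!fmap_comp Hv0'.
exists (ep ∘ v0'); split.
  split; first by rewrite /= epb v0b' comp_idl.
  split; first by rewrite -comp_assoc v0e k2.
  by rewrite -comp_assoc v0bq fmap_comp !comp_assoc gm2.
move=> v [vb [ve vbq]].
(* A competitor [v] transposes to [n], which is shown to be an algebra map extending [k], hence
   equal to [v0]. *)
have [|n [[nb [n' [n1 n2]]] _]] := U (R' f) q c v (idc _) Hc; first by rewrite cb vb.
have nb' : hbase n' = idc _.
  have := f_equal (fun x : vhom _ _ => hbase x) n2.
  by rewrite /= epb vb comp_idl.
have nk : k = n ∘ eta' f.
  apply: kU; split; first by rewrite /= nb comp_idl.
  exists (n' ∘ e); rewrite !comp_assoc n1 n2 ve; split=> //.
  by rewrite -!comp_assoc ce.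
(* Both sides are transposes of [v ∘ bq]. *)
have nalg : n ∘ free_str f = gm ∘ fmap R n.
  have [||r [_ Hr]] := U (R (R' f)) (R q) (fmap R c) (v ∘ bq) (idc _).
  - exact: (proj2 (HS Hc)).
  - by rewrite /= cb vb bqb comp_idl.
  transitivity r; [symmetry|]; apply: Hr.
  - split; first by rewrite /= nb aw_mult_base !comp_idl.
    exists (n' ∘ bq); rewrite !comp_assoc n1 n2; split=> //.
    by rewrite -comp_assoc cbq /free_str !comp_assoc.
  - split; first by rewrite /= gmb nb comp_idl.
    exists (gm' ∘ fmap R n'); rewrite !comp_assoc gm1 gm2 vbq.
    by rewrite -!comp_assoc -!fmap_comp n1 n2.
have En : v0 = n by apply: v0U.
rewrite -n2; congr (_ ∘ _).
apply: (cartesian_ext Hd); first by rewrite v0b' nb'.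
by rewrite Hv0' n1 En.
Qed.

End Reindexing.

(** Let [q] be the reindexing of [R' f]. Freeness of [R' f'] gives [ph] into [q], freeness of [q]
    gives [ps] back, and uniqueness of extensions makes them inverse. *)
Lemma algebraically_free_fibred : is_fibred A.
Proof.
apply: is_fibred_of_R => // f' f h Hh.
have [cq [dq [pq [aq [c [cb /vpb_cartesian Hc]]]]]] :=
  vpb_exists C_lccc (g := R' f) (hbase h).
move: c cb Hc; set q : vert_cat C := VMap pq aq => c cb Hc.
have sb := algebra_hbase (free_str_unit f).
(* [bq] is the algebra structure of [R' f] reindexed to [q]; its unit law is inherited through the
   cartesian [c]. *)
have [|bq [bqb cbq]] := cartesian_lift Hc (k := free_str f ∘ fmap R c) (t := idc _).
  by rewrite -[RHS]/(hbase (free_str f) ∘ hbase c) sb comp_idl comp_idr.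
have bq_unit : bq ∘ eta q = idc q.
  apply: (cartesian_ext Hc); first by rewrite /= bqb comp_idl.
  by rewrite comp_assoc cbq -comp_assoc -Runit_nat comp_assoc free_str_unit comp_idl comp_idr.
have [|e [eb ce]] := cartesian_lift Hc (k := eta' f ∘ h) (t := idc _).
  by rewrite /= cb comp_idl comp_idr.
have [ph [[ph1 ph2] _]] := free_extension e bq_unit.
have phb : hbase ph = idc _.
  by have := f_equal (fun x : vhom _ _ => hbase x) ph1; rewrite /= eb comp_idr.
(* Both are algebra maps out of the free algebra on [f'] with the same restriction along the unit.
   Hence [fmap R' h] is cartesian once [ph] is invertible. *)
have Eh : c ∘ ph = fmap R' h.
  apply: (free_extension_ext (free_str_unit f)).
  - by rewrite -comp_assoc ph2 comp_assoc cbq -comp_assoc -fmap_comp.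
  - exact: free_str_nat.
  - by rewrite -comp_assoc ph1 ce; apply: Runit_nat.
have free := reindexed_free Hh Hc cb eb ce bq_unit cbq.
have [ps [[psb [ps1 ps2]] _]] :=
  free _ _ _ _ (free_str f') (eta' f') (free_str_unit f') erefl.
have E1 : ps ∘ ph = idc _.
  apply: (free_extension_ext (free_str_unit f')).
  - by rewrite -comp_assoc ph2 comp_assoc ps2 -comp_assoc -fmap_comp.
  - by rewrite fmap_id comp_idl comp_idr.
  - by rewrite -comp_assoc ph1 ps1 comp_idl.
have E2 : ph ∘ ps = idc _.
  have [r [_ Hr]] := free _ _ _ _ bq e bq_unit eb.
  transitivity r; [symmetry|]; apply: Hr.
  - split; first by rewrite /= phb psb comp_idl.
    split; first by rewrite -comp_assoc ps1 ph1.
    by rewrite -comp_assoc ps2 comp_assoc ph2 -comp_assoc -fmap_comp.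
  - by rewrite !comp_idl fmap_id comp_idr.
by rewrite -Eh; apply: cartesian_comp => //; apply: iso_cartesian E2 E1.
Qed.

End AlgebraicallyFree.

Theorem theorem7p5p2 (C : category) (C_lccc : is_lccc C)
  (C_lim : has_finite_limits C) (C_po : has_pushouts C) (m : vert_cat C) :
  (forall f : vert_cat C, exists U : lifting_problem m f, is_universal_lp U) /\
  (forall (f : vert_cat C) (U : lifting_problem m f), is_universal_lp U ->
     exists (K : factorisation f) (k : hom (lp_map U) (Lob K)), is_step_one_factor k) /\
  inhabited (step_one m) /\
  (forall D : step_one m, exists S : lawfs (so_fact D),
     unique (@is_step_one_lawfs C m D) S /\
     (forall f : vert_cat C,
        (forall a : hom (Rob (so_fact D f)) f, is_R_algebra a ->
           is_solution (P := so_lp D f) (hdom a ∘ hcod (so_k D f))) /\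
        (forall j : hom (vcod (lp_map (so_lp D f))) (vdom f),
           is_solution (P := so_lp D f) j ->
           exists! a : hom (Rob (so_fact D f)) f,
             is_R_algebra a /\ hdom a ∘ hcod (so_k D f) = j)) /\
     is_fibred S /\
     (forall (K : forall f : vert_cat C, factorisation f) (A : awfs K)
        (theta : lawfs_hom S A), algebraically_free theta -> is_fibred A)).
Proof.
have ex_lp := universal_lp_exists C_lccc C_lim m.
have ex_fact f U (_ : is_universal_lp U) := @step_one_factor_exists C m f U C_po.
split=> //; split=> //; split.
  pose lp f := constructive_indefinite_description _ (ex_lp f).
  pose fact f := constructive_indefinite_description _ (ex_fact f _ (proj2_sig (lp f))).
  pose k f := constructive_indefinite_description _ (proj2_sig (fact f)).
  exact: (inhabits (@StepOne C m _ (fun f => proj2_sig (lp f)) _ _ (fun f => proj2_sig (k f)))).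
move=> D; exists (step_one_lawfs D).
have HS := step_one_lawfs_unique D; have HF := step_one_fibred C_lccc C_lim (proj1 HS).
split=> //; split.
  move=> f; split.
  - by move=> a; apply: algebra_solution (so_kP D f) _.
  - by move=> j; apply: solution_algebra (so_kP D f) _.
by split=> // K A theta; apply: algebraically_free_fibred.
Qed.
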